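(* Let $k$ be a finite field of characteristic different from $2$, and let $C$ be a smooth plane quartic over $k$ with automorphism group $\mathbf{C}_2$. Let $\alpha$ be a non-square element in $k$. Then $C$ is $k$-isomorphic to a plane quartic curve of one of the following forms, with coefficients $a,b,c,d,e\in k$: (i) $x^4+\epsilon x^2 y^2 + a y^4+\mu y^3 z+b y^2 z^2+c y z^3+d z^4 = 0$ with $\epsilon\in\{1,\alpha\}$ and $\mu\in\{0,1\}$; (ii) $x^4+x^2 y z + a y^4+\epsilon y^3 z+b y^2 z^2+c y z^3+d z^4 = 0$ with $\epsilon\in\{0,1,\alpha\}$; (iii) $x^4+x^2 (y^2-\alpha z^2) + a y^4+b y^3 z+c y^2 z^2+d y z^3+e z^4 = 0$.
   Context: $\mathbf{C}_2$ denotes the cyclic group of order $2$. The automorphism group of $C$ is its geometric automorphism group, i.e. the group of automorphisms of $C$ over $\overline{k}$. *)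

(* Defs.v *)
From HB Require Import structures.
From mathcomp Require Import all_boot all_order all_fingroup all_algebra.
From mathcomp Require Import mpoly.

Set Implicit Arguments.
Unset Strict Implicit.
Unset Printing Implicit Defensive.

Import GRing.Theory.
Local Open Scope ring_scope.

(* Plane curves are given by ternary forms over k, and treated as classical   *)
(* projective varieties through their points over an algebraically closed     *)
(* field K, with k embedded in K by iota. A point of P^2(K) is represented by *)
(* a nonzero row vector; two nonzero vectors represent the same point iff     *)
(* they span the same line, i.e. (p == q)%MS.                                 *)

Section PlaneCurves.

Variables (k : fieldType) (K : closedFieldType) (iota : {rmorphism k -> K}).

Definition form_at (P : {mpoly k[3]}) (p : 'rV[K]_3) : K :=
  (map_mpoly iota P).@[p 0].

Definition forms_at (P : 'I_3 -> {mpoly k[3]}) (p : 'rV[K]_3) : 'rV[K]_3 :=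
  \row_i form_at (P i) p.

Definition on_curve (F : {mpoly k[3]}) (p : 'rV[K]_3) : bool :=
  (p != 0) && (form_at F p == 0).

(* This excludes F = 0. *)
Definition smooth_curve (F : {mpoly k[3]}) : Prop :=
  forall p, on_curve F p -> exists i : 'I_3, form_at F^`M(i) p != 0.

Definition smooth_plane_quartic (F : {mpoly k[3]}) : Prop :=
  F \is 4%N.-homog /\ smooth_curve F.

(* A map of projective varieties is a morphism defined over k when, around    *)
(* each geometric point, it is given by forms of equal degree over k without  *)
(* common zero at that point. The values of phi off the curve F = 0 are       *)
(* irrelevant; compatibility of phi with rescaling p on the curve follows.    *)
Definition curve_morphism (F G : {mpoly k[3]}) (phi : 'rV[K]_3 -> 'rV[K]_3) :
    Prop :=
  (forall p, on_curve F p -> on_curve G (phi p)) /\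
  (forall p, on_curve F p ->
     exists (d : nat) (P : 'I_3 -> {mpoly k[3]}),
       [/\ forall i, P i \is d.-homog,
           forms_at P p != 0
         & forall q, on_curve F q -> forms_at P q != 0 ->
             (phi q == forms_at P q)%MS]).

Definition same_map (F : {mpoly k[3]}) (phi psi : 'rV[K]_3 -> 'rV[K]_3) :
    Prop :=
  forall p, on_curve F p -> (phi p == psi p)%MS.

Definition curve_isomorphism (F G : {mpoly k[3]})
    (phi : 'rV[K]_3 -> 'rV[K]_3) : Prop :=
  curve_morphism F G phi /\
  exists psi, [/\ curve_morphism G F psi,
                  same_map F (psi \o phi) id
                & same_map G (phi \o psi) id].

Definition curves_isomorphic (F G : {mpoly k[3]}) : Prop :=
  exists phi, curve_isomorphism F G phi.

Definition curve_automorphism (F : {mpoly k[3]})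
    (phi : 'rV[K]_3 -> 'rV[K]_3) : Prop :=
  curve_isomorphism F F phi.

(* The group of automorphisms over k of the curve F = 0, with maps identified *)
(* when they agree on the curve, is isomorphic to gT.                         *)
Definition aut_group_isog (F : {mpoly k[3]}) (gT : finGroupType) : Prop :=
  exists rho : gT -> 'rV[K]_3 -> 'rV[K]_3,
    [/\ forall g, curve_automorphism F (rho g),
        forall g h, same_map F (rho (g * h)%g) (rho g \o rho h),
        forall g h, same_map F (rho g) (rho h) -> g = h
      & forall phi, curve_automorphism F phi ->
          exists g, same_map F phi (rho g)].

End PlaneCurves.

Definition geom_aut_group_isog (k : fieldType) (K : closedFieldType)
    (iota : {rmorphism k -> K}) (F : {mpoly k[3]}) (gT : finGroupType) : Prop :=
  aut_group_isog (idfun : {rmorphism K -> K}) (map_mpoly iota F) gT.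

Section NormalForms.

Variable k : fieldType.

Local Notation x := ('X_(0 : 'I_3) : {mpoly k[3]}).
Local Notation y := ('X_(1 : 'I_3) : {mpoly k[3]}).
Local Notation z := ('X_(2 : 'I_3) : {mpoly k[3]}).

Definition quartic_i (eps a mu b c d : k) : {mpoly k[3]} :=
  x ^+ 4 + eps *: (x ^+ 2 * y ^+ 2) + a *: y ^+ 4 + mu *: (y ^+ 3 * z)
  + b *: (y ^+ 2 * z ^+ 2) + c *: (y * z ^+ 3) + d *: z ^+ 4.

Definition quartic_ii (a eps b c d : k) : {mpoly k[3]} :=
  x ^+ 4 + x ^+ 2 * y * z + a *: y ^+ 4 + eps *: (y ^+ 3 * z)
  + b *: (y ^+ 2 * z ^+ 2) + c *: (y * z ^+ 3) + d *: z ^+ 4.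

Definition quartic_iii (alpha a b c d e : k) : {mpoly k[3]} :=
  x ^+ 4 + x ^+ 2 * (y ^+ 2 - alpha *: z ^+ 2) + a *: y ^+ 4
  + b *: (y ^+ 3 * z) + c *: (y ^+ 2 * z ^+ 2) + d *: (y * z ^+ 3)
  + e *: z ^+ 4.

End NormalForms.

(* Main.v *)
(* An automorphism s of a smooth plane quartic F = 0 is linear, because the   *)
(* canonical map of the curve is its embedding in the plane. Concretely, if s *)
(* is given near q by forms P and v is tangent to the cone F = 0 at q, scaled *)
(* so that q x v = grad F(q), then P x d_v P = c grad F(P), and the vector    *)
(* c P(q) is a regular section of degree 1 along the curve, independent of P. *)
(* Such a section is linear in q: in an affine chart where F is monic in z it *)
(* is polynomial, as the ideal of its denominators has no zero, and comparing *)
(* two charts bounds the degree.                                              *)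
(*                                                                            *)
(* The nontrivial automorphism is thus given by a matrix M, which may be      *)
(* normalised to have square 1. Its Frobenius conjugate also induces a        *)
(* nontrivial automorphism, so that M is defined over k. Diagonalising M      *)
(* turns the quartic into a x^4 + x^2 q(y, z) + r(y, z), where a <> 0 by      *)
(* smoothness, and q <> 0 since otherwise x |-> i x would be a further        *)
(* automorphism. It remains to classify binary quadratic forms q over the     *)
(* finite field k: rank one, split (y z), or anisotropic (the norm form       *)
(* y^2 - alpha z^2, as norms are surjective), and then to rescale y and z.    *)

(* Linearity is [regular_linear]. [affine_ideal_unit], a Nullstellensatz on a chart, makes a section
   with local denominators polynomial, and [linear_section] makes a section of degree 1 a linear
   form; this is applied to the coordinates of the canonical vector. The other recurrent tool is
   [small_vanish]: a form of degree below 4 that vanishes on the quartic is zero. It gives the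
   invertibility of the matrix and, applied to 2 by 2 minors, the fact that matrices inducing the
   same map are proportional ([same_linear_map]).

   The group hypothesis enters in [geometric_involution]: a matrix preserving the curve is a scalar
   or a scalar multiple of one involution [M]. This uniqueness lets [involution_descent] compare [M]
   with its Frobenius conjugate, and lets [even_reduction] exclude [q = 0].

   The finiteness of [k] is used again in [square_class] and [norm_surjective]: each nonzero element
   is a square or [alpha] times a square, and is a norm. These bring [q] to normal form
   ([conic_normal_form]). In the first two cases a diagonal scaling that preserves [q] is still
   available, and it normalises the coefficient of [y^3 z]. *)
Require Import Defs.
From HB Require Import structures.
From mathcomp Require Import all_boot all_order all_fingroup all_algebra.
From mathcomp Require Import all_solvable finfield.
From mathcomp Require Import mpoly.
From mathcomp Require Import ring zify.
From Stdlib Require Import IndefiniteDescription.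

Set Implicit Arguments.
Unset Strict Implicit.
Unset Printing Implicit Defensive.

Import GRing.Theory.
Local Open Scope ring_scope.

(** * Affine plane curves monic in one variable *)

Section AffineCurves.

Variable K : closedFieldType.
Implicit Types (p e : {poly K}) (f g Q R : {poly {poly K}}) (a b : K).

Definition fiber g a : {poly K} := map_poly (horner_eval a) g.

Lemma fiberD f g a : fiber (f + g) a = fiber f a + fiber g a.
Proof. exact: rmorphD. Qed.

Lemma fiberM f g a : fiber (f * g) a = fiber f a * fiber g a.
Proof. exact: rmorphM. Qed.

Lemma fiberZ (c : {poly K}) g a : fiber (c *: g) a = c.[a] *: fiber g a.
Proof. by rewrite /fiber map_polyZ. Qed.

Lemma fiberX a : fiber 'X a = 'X.
Proof. exact: map_polyX. Qed.

Lemma fiberC p a : fiber p%:P a = p.[a]%:P.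
Proof. exact: map_polyC. Qed.

Lemma fiber_lift p a : fiber (map_poly polyC p) a = p.
Proof.
by apply/polyP=> i; rewrite !coef_map /= /horner_eval hornerC.
Qed.

(** An algebraically closed field is infinite: for nonzero [p] the polynomial [p * 'X + 1] would
    have a root, but it takes only the value 1. *)
Lemma vanish_poly_eq0 p : (forall a, p.[a] = 0) -> p = 0.
Proof.
move=> p0; apply/eqP/negPn/negP=> pn0.
have /closed_rootP[r] : size (p * 'X + 1) != 1%N.
  rewrite size_MXaddC (negPf pn0) /= eqSS size_poly_eq0 //.
by rewrite rootE !hornerE p0 mul0r add0r oner_eq0.
Qed.

Lemma fiber_eq0 g a : fiber g a = 0 -> exists h, g = ('X - a%:P) *: h.
Proof.
move=> g0; exists (map_poly (fun p => p %/ ('X - a%:P)) g).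
apply/polyP=> i; rewrite coefZ coef_map_id0 ?div0p // mulrC divpK //.
by rewrite dvdp_XsubCl rootE -[_.[a]](coef_map (horner_eval a)) -/(fiber g a) g0
  coef0.
Qed.

(** Gauss's lemma, removing the roots of [c] one at a time: over a root [a] the fibres of [Q] and
    [R] have product zero, so ['X - a%:P] divides one of the two factors. What is taken out of [R]
    accumulates in [c1]. *)
Lemma monic_factor (c : {poly K}) f Q R : f \is monic -> c != 0 ->
    c *: f = Q * R ->
  exists (c1 : {poly K}) (Q1 R1 : {poly {poly K}}),
    [/\ c1 != 0, R = c1 *: R1 & f = Q1 * R1].
Proof.
move=> mf; have [n] := ubnP (size c); elim: n => // n IHn in c Q R *.
rewrite ltnS => le_cn c0 cf; have [/eqP sc|sc] := boolP (size c == 1%N).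
  have [u u0 cu] := size_poly1P c (introT eqP sc).
  exists 1, (u^-1%:P *: Q), R; rewrite oner_neq0 scale1r; split=> //.
  by rewrite -scalerAl -cf scalerA cu -polyCM mulVf // scale1r.
have /closed_rootP[a /factor_theorem[c' Dc]] := sc.
have X0 : 'X - a%:P != 0 :> {poly K} by rewrite polyXsubC_eq0.
have c'0 : c' != 0 by apply: contraNneq c0 => c'0; rewrite Dc c'0 mul0r.
have lt_c' : (size c' < n)%N.
  by move: le_cn; rewrite Dc size_Mmonic ?monicXsubC // size_XsubC addn2.
have : fiber Q a * fiber R a = 0.
  by rewrite -fiberM -cf fiberZ Dc !hornerE subrr mulr0 scale0r.
have canc g h : ('X - a%:P) *: g = ('X - a%:P) *: h -> g = h.
  by move=> gh; apply/polyP=> i; apply: (mulfI X0); rewrite -!coefZ gh.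
move/eqP; rewrite mulf_eq0 => /orP[] /eqP/fiber_eq0[h Dh].
  apply: (IHn c' h R) => //; apply: canc.
  by rewrite scalerAl -Dh -cf scalerA mulrC -Dc.
have [|c1 [Q1 [R1 [c10 Dh' ->]]]] := IHn c' Q h lt_c' c'0.
  by apply: canc; rewrite scalerAr -Dh -cf scalerA mulrC -Dc.
exists (('X - a%:P) * c1), Q1, R1; split=> //; first by rewrite mulf_neq0.
by rewrite Dh Dh' scalerA.
Qed.

(* No point lies on both factors of a factorisation of f: this is all that    *)
(* smoothness of the curve f = 0 is needed for.                               *)
Definition nonsing f := forall Q R a b, f = Q * R ->
  (fiber Q a).[b] = 0 -> (fiber R a).[b] = 0 -> False.

(** Exempting the fibres over the roots of [e] allows a test on the overlap of two charts only, with
    [e := 'X]. *)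
Definition vanishes_on f e g := forall a b,
  e.[a] != 0 -> (fiber f a).[b] = 0 -> (fiber g a).[b] = 0.

Lemma poly_nonroot e : e != 0 -> exists a, e.[a] != 0.
Proof.
move=> e0; have /closed_nonrootP[a] := e0; by exists a.
Qed.

(* Pseudo-division of f by an R of minimal degree gives f = Q1 * R1 up to     *)
(* Gauss's lemma; a root of Q1 over a general t lies on f = 0, hence on       *)
(* R1 = 0 as well.                                                            *)
Lemma vanishing_small_eq0 f e R : f \is monic -> nonsing f -> e != 0 ->
  vanishes_on f e R -> (size R < size f)%N -> R = 0.
Proof.
move=> mf ns e0; have [n] := ubnP (size R); elim: n => // n IHn in R *.
rewrite ltnS => le_Rn vR ltR; apply/eqP/negPn/negP => R0.
pose c := lead_coef R ^+ scalp f R.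
have c0 : c != 0 by rewrite expf_neq0 // lead_coef_eq0.
have Df : c *: f = (f %/ R)%R * R + f %% R by exact: Pdiv.Idomain.divp_eq.
have lt_m : (size (f %% R)%R < size R)%N by rewrite ltn_modp.
have m0 : (f %% R)%R = 0.
  apply: IHn; first exact: leq_trans lt_m le_Rn; last exact: ltn_trans ltR.
  move=> a b ea fab; have := congr1 (fun g => (fiber g a).[b]) Df.
  rewrite fiberZ fiberD fiberM hornerZ hornerD hornerM fab vR //.
  by rewrite !mulr0 add0r.
rewrite m0 addr0 in Df.
have [c1 [Q1 [R1 [c10 DR Df1]]]] := monic_factor mf c0 Df.
have [a] : exists a, (e * c1).[a] != 0 by apply: poly_nonroot;
  rewrite mulf_neq0.
rewrite hornerM mulf_eq0 negb_or => /andP[ea ca].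
have sR1 : size R1 = size R by rewrite DR size_scale.
have f0 : f != 0 by rewrite monic_neq0.
have QR0 : Q1 * R1 != 0 by rewrite -Df1.
have /andP[Q10 R10] : (Q1 != 0) && (R1 != 0) by rewrite mulf_eq0 negb_or in QR0.
have sQ : (1 < size Q1)%N.
  move: ltR; rewrite Df1 size_mul // sR1.
  have : (0 < size R)%N by rewrite size_poly_gt0.
  by case: (size R) => // m _;
    rewrite addnS /= -[X in (X < _)%N]add1n ltn_add2r.
(* As [f] is monic, the leading coefficient of [Q1] is invertible, so the fibre of [Q1] keeps its
   positive degree and has a root. *)
have lcQ : lead_coef Q1 * lead_coef R1 = 1 by
  rewrite -lead_coefM -Df1 (monicP mf).
have lcQa : (lead_coef Q1).[a] != 0.
  by have := congr1 (horner_eval a) lcQ;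
    rewrite rmorphM rmorph1 /= /horner_eval => /eqP; apply: contraTneq => ->;
      rewrite mul0r eq_sym oner_neq0.
have : size (fiber Q1 a) != 1%N by rewrite /fiber size_map_poly_id0 // gtn_eqF.
case/closed_rootP=> b /eqP Qb.
apply: (ns Q1 R1 a b) => //; have := vR a b ea.
rewrite {1}Df1 fiberM hornerM Qb mul0r DR fiberZ hornerZ => /(_ erefl)/eqP.
by rewrite mulf_eq0 (negPf ca) => /eqP.
Qed.

Lemma vanishing_multiple f e g : f \is monic -> nonsing f -> e != 0 ->
  vanishes_on f e g -> exists q, g = q * f.
Proof.
move=> mf ns e0 vg; exists (Pdiv.Ring.rdivp g f).
have Dg := Pdiv.RingMonic.rdivp_eq mf g.
suff r0 : Pdiv.Ring.rmodp g f = 0 by rewrite {1}Dg r0 addr0.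
apply: (vanishing_small_eq0 mf ns e0);
  last by rewrite Pdiv.Ring.ltn_rmodp monic_neq0.
move=> a b ea fab; have := vg a b ea fab.
by rewrite {1}Dg fiberD fiberM hornerD hornerM fab mulr0 add0r.
Qed.

(** The Nullstellensatz in one variable, by Euclidean descent: if [h] in [J] has a root [b],
    reducing modulo [h] an element that is nonzero at [b] gives a nonzero element of smaller
    degree. *)
Lemma poly_ideal_unit (J : {poly K} -> Prop) :
    (forall p q, J p -> J q -> J (p + q)) -> (forall p q, J q -> J (p * q)) ->
    (forall b, exists p, J p /\ p.[b] != 0) ->
  J 1.
Proof.
move=> JD JM Jb.
have [h [h0 Jh]] : exists h : {poly K}, h != 0 /\ J h.
  have [g [Jg gb]] := Jb 0; exists g; split=> //.
  by apply: contraNneq gb => ->; rewrite horner0.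
have [n] := ubnP (size h); elim: n => // n IHn in h h0 Jh *.
rewrite ltnS => le_hn;
  have [/eqP sh|/closed_rootP[b hb]] := boolP (size h == 1%N).
  have [u u0 Dh] := size_poly1P h (introT eqP sh).
  have -> : 1 = u^-1%:P * h by rewrite Dh -polyCM mulVf.
  exact: JM.
have [g [Jg gb]] := Jb b.
have Dm : (g %% h)%R = g + (- (g %/ h)%R) * h.
  by rewrite [X in X + _](divp_eq g h) mulNr addrAC subrr add0r.
apply: (IHn (g %% h)%R).
- apply: contraNneq gb => m0; rewrite (divp_eq g h) m0 addr0 hornerM.
  by rewrite (eqP hb) mulr0.
- by rewrite Dm; apply: JD => //; apply: JM.
- by apply: leq_trans le_hn; rewrite ltn_modp.
Qed.

(** The Nullstellensatz for an ideal containing a monic [f], from two uses of the one-variable case.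
    On the fibre over [a] some [g] in [J] restricts to 1; the resultant of [f] and a suitable
    modification of [g] is then an element of [J] in the base variable alone, nonzero at [a]. *)
Lemma affine_ideal_unit f (J : {poly {poly K}} -> Prop) :
    f \is monic -> (1 < size f)%N -> J f ->
    (forall g h, J g -> J h -> J (g + h)) -> (forall u g, J g -> J (u * g)) ->
    (forall a b, (fiber f a).[b] = 0 -> exists g, J g /\ (fiber g a).[b] != 0)
      ->
  J 1.
Proof.
move=> mf sf Jf JD JM Jab; rewrite -polyC1.
apply: (@poly_ideal_unit (fun p => J p%:P)).
- by move=> g h; rewrite polyCD; apply: JD.
- by move=> u g; rewrite polyCM; apply: JM.
move=> a.
have [g [Jg ga]] : exists g, J g /\ fiber g a = 1.
  apply: (@poly_ideal_unit (fun h => exists g, J g /\ fiber g a = h)).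
  - by move=> _ _ [g [Jg <-]] [h [Jh <-]]; exists (g + h); rewrite fiberD; auto.
  - move=> u _ [g [Jg <-]]; exists (map_poly polyC u * g).
    by rewrite fiberM fiber_lift; auto.
  move=> b; have [/eqP fab|fab] := boolP ((fiber f a).[b] == 0).
    by have [g [Jg gab]] := Jab a b fab; exists (fiber g a); split=> //;
      exists g.
  by exists (fiber f a); split=> //; exists f.
(* Adding a high multiple of f makes g monic, so that the resultant          *)
(* specialises at t = a.                                                     *)
pose n := size g; pose g1 := 'X^n * f + g.
have lt_g : (size g < size ('X^n * f)%R)%N.
  rewrite mulrC size_Mmonic ?monicXn ?monic_neq0 // size_polyXn addnS /=.
  by rewrite -/n -[X in (X < _)%N]add0n ltn_add2r ltnW.
have sg1 : size g1 = size ('X^n * f) by rewrite /g1 size_polyDl.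
have mg1 : g1 \is monic.
  by rewrite monicE /g1 lead_coefDl // -monicE rpredM ?monicXn.
have sg1_gt1 : (1 < size g1)%N.
  rewrite sg1 mulrC size_Mmonic ?monicXn ?monic_neq0 // size_polyXn addnS /=.
  exact: leq_trans sf (leq_addr _ _).
have [[u v] /= _ Dr] := resultant_in_ideal sf sg1_gt1.
exists (resultant f g1); split.
  by rewrite Dr; apply/JD/JM/JD => //; exact: JM.
rewrite -/(horner_eval a _) map_resultant; first last.
- by rewrite (monicP mg1) rmorph1 oner_neq0.
- by rewrite (monicP mf) rmorph1 oner_neq0.
rewrite resultant_eq0 -/(fiber f a) -/(fiber g1 a) /g1 fiberD fiberM ga -leqNgt.
have : coprimep (fiber f a) (fiber 'X^n a * fiber f a + 1).
  by rewrite coprimep_addl_mul coprimep1.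
by rewrite coprimep_def => /eqP ->.
Qed.

End AffineCurves.

(** * Directional derivatives of polynomials *)

Section MpolyCalculus.

Variables (n : nat) (R : comNzRingType).
Implicit Types (G : {mpoly R[n]}) (p v : 'rV[R]_n).

Lemma mpoly_alg_ind (P : {mpoly R[n]} -> Prop) :
    (forall c, P c%:MP) -> (forall i, P 'X_i) ->
    (forall G H, P G -> P H -> P (G + H)) ->
    (forall G H, P G -> P H -> P (G * H)) ->
  forall G, P G.
Proof.
move=> PC PX PD PM G; rewrite (mpolyE G).
elim/big_ind: _ => [|G1 G2|m _]; [by rewrite -mpolyC0 | exact: PD |].
rewrite -mul_mpolyC mpolyXE_id; apply: (PM) => //.
elim/big_ind: _ => [|G1 G2|i _]; [by rewrite -mpolyC1 | exact: PM |].
elim: (m i) => [|j IH]; first by rewrite expr0 -mpolyC1.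
by rewrite exprS; apply: (PM).
Qed.

Lemma rmorph_mmap (S T : comNzRingType) (f : {rmorphism R -> S})
    (g : {rmorphism S -> T}) (h : 'I_n -> S) G :
  g (mmap f h G) = mmap (g \o f) (g \o h) G.
Proof.
rewrite /mmap rmorph_sum; apply: eq_bigr => m _; rewrite rmorphM; congr (_ * _).
by rewrite /mmap1 rmorph_prod; apply: eq_bigr => i _; rewrite rmorphXn.
Qed.

Lemma eq_mmap (S : comNzRingType) (f1 f2 : R -> S) (h1 h2 : 'I_n -> S) G :
  f1 =1 f2 -> h1 =1 h2 -> mmap f1 h1 G = mmap f2 h2 G.
Proof.
move=> f12 h12; apply: eq_bigr => m _; rewrite f12; congr (_ * _).
by apply: eq_bigr => i _; rewrite h12.
Qed.

Lemma mmap_homog (S : comNzRingType) (f : {rmorphism R -> S}) (h : 'I_n -> S)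
    (c : S) d G :
  G \is d.-homog -> mmap f (fun i => c * h i) G = c ^+ d * mmap f h G.
Proof.
move/dhomogP=> hG; rewrite /mmap big_distrr /=;
  apply: eq_big_seq => m /hG /= dm.
rewrite mulrCA; congr (_ * _); rewrite /mmap1 -dm mdegE -prodrXr -big_split /=.
by apply: eq_bigr => i _; rewrite exprMn.
Qed.

Lemma meval_homog (c : R) d G p :
  G \is d.-homog -> G.@[(c *: p) 0] = c ^+ d * G.@[p 0].
Proof.
move=> hG; rewrite -(mmap_homog idfun (p 0) c hG).
by apply: eq_mmap => // i; rewrite mxE.
Qed.

Lemma mderiv_homog d G i : G \is d.-homog -> G^`M(i) \is d.-1.-homog.
Proof.
move/dhomogP=> hG; apply/dhomogP=> m; rewrite mcoeff_msupp mcoeff_deriv => nz.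
have /hG /= <- : (m + U_(i))%MM \in msupp G.
  by rewrite mcoeff_msupp; apply: contraNneq nz => ->; rewrite mul0rn.
by rewrite mdegD mdeg1 addn1.
Qed.

Lemma deriv_mmap (h : 'I_n -> {poly R}) G :
  (mmap polyC h G)^`() = \sum_i (h i)^`() * mmap polyC h G^`M(i).
Proof.
elim/mpoly_alg_ind: G => [c|i|G H IG IH|G H IG IH].
- by rewrite mmapC derivC big1 // => i _; rewrite mderivC mmap0 mulr0.
- rewrite mmapX mmap1U (bigD1 i) //= big1 => [|j neq_ji].
    rewrite addr0 mderivX mnm1E eqxx scale1r.
    have -> : (U_(i) - U_(i))%MM = 0%MM :> 'X_{1..n}.
      by apply/mnmP=> j; rewrite mnmBE subnn mnm0E.
    by rewrite mmapX mmap11 mulr1.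
  by rewrite mderivX mnm1E eq_sym (negPf neq_ji) scale0r mmap0 mulr0.
- rewrite mmapD derivD IG IH -big_split /=; apply: eq_bigr => i _.
  by rewrite mderivD mmapD mulrDr.
rewrite rmorphM derivM IG IH big_distrl big_distrr /= -big_split /=.
apply: eq_bigr => i _; rewrite mderivM mmapD !rmorphM /=.
by rewrite mulrDr !mulrA; congr (_ + _); rewrite mulrAC mulrC mulrA mulrC.
Qed.

(** The restriction of [G] to the line [p + s v]; it reduces calculus in several variables to
    one. *)
Definition line p v G : {poly R} :=
  mmap polyC (fun i => (p 0 i)%:P + v 0 i *: 'X) G.

Definition dderiv G p v : R := \sum_i v 0 i * (G^`M(i)).@[p 0].

Lemma horner_mmap (h : 'I_n -> {poly R}) G s :
  (mmap polyC h G).[s] = G.@[fun i => (h i).[s]].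
Proof.
rewrite -/(horner_eval s _) rmorph_mmap /meval; apply: eq_mmap => // c /=.
by rewrite /horner_eval hornerC.
Qed.

Lemma horner_line p v G s : (line p v G).[s] = G.@[(p + s *: v) 0].
Proof.
rewrite horner_mmap; apply: meval_eq => i.
by rewrite !mxE !hornerE mulrC.
Qed.

Lemma horner0_deriv_mmap (h : 'I_n -> {poly R}) G :
  (mmap polyC h G)^`().[0] =
  dderiv G (\row_i (h i).[0]) (\row_i (h i)^`().[0]).
Proof.
rewrite deriv_mmap horner_sum; apply: eq_bigr => i _.
rewrite hornerM horner_mmap !mxE; congr (_ * _).
by apply: meval_eq => j; rewrite mxE.
Qed.

Lemma deriv_line p v G : (line p v G)^`().[0] = dderiv G p v.
Proof.
rewrite horner0_deriv_mmap; congr (dderiv G _ _); apply/rowP=> i; rewrite !mxE.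
  by rewrite !hornerE.
by rewrite !derivE !hornerE.
Qed.

End MpolyCalculus.

Section MpolyCalculusMore.

Variable R : comNzRingType.

Lemma dderiv_comp m n (P : 'I_m -> {mpoly R[n]}) (G : {mpoly R[m]})
  (p v : 'rV_n) :
  dderiv (mmap (@mpolyC n R) P G) p v =
  dderiv G (\row_i (P i).@[p 0]) (\row_i dderiv (P i) p v).
Proof.
rewrite -deriv_line /line rmorph_mmap.
rewrite (eq_mmap (f2 := polyC) (h2 := fun i => line p v (P i))) //; last first.
  by move=> c /=; rewrite mmapC.
rewrite horner0_deriv_mmap; congr (dderiv G _ _); apply/rowP=> i; rewrite !mxE.
  by rewrite horner_line scale0r addr0.
by rewrite deriv_line.
Qed.

Lemma comp_homog n m d e (P : 'I_m -> {mpoly R[n]}) (G : {mpoly R[m]}) :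
    (forall i, P i \is d.-homog) -> G \is e.-homog ->
  mmap (@mpolyC n R) P G \is (d * e)%N.-homog.
Proof.
move=> hP /dhomogP hG; rewrite /mmap big_seq; apply: rpred_sum => a /hG /= <-;
  rewrite mul_mpolyC.
apply: dhomogZ; rewrite mdegE big_distrr /=.
rewrite /mmap1; apply: (big_rec2 (fun (H : {mpoly R[n]}) k => H \is k.-homog)).
  exact: dhomog1.
by move=> i H k _ hH; apply: dhomogM hH; apply: dhomogMn.
Qed.

Variable n : nat.
Implicit Types (G : {mpoly R[n]}) (p v : 'rV[R]_n).

Lemma dderivM G H p v : dderiv (G * H) p v = dderiv G p v * H.@[p 0] +
  G.@[p 0] * dderiv H p v.
Proof.
rewrite -!deriv_line {1}/line rmorphM /= -!/(line _ _ _).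
by rewrite derivM hornerD !hornerM !horner_line scale0r addr0.
Qed.

Lemma dderivD G H p v : dderiv (G + H) p v = dderiv G p v + dderiv H p v.
Proof. by rewrite -!deriv_line {1}/line rmorphD /= derivD hornerD. Qed.

Lemma dderivB G H p v : dderiv (G - H) p v = dderiv G p v - dderiv H p v.
Proof. by rewrite -!deriv_line {1}/line rmorphB /= derivB hornerD hornerN. Qed.

Lemma dderivX i p v : dderiv 'X_i p v = v 0 i.
Proof.
rewrite -deriv_line /line mmapX mmap1U.
by rewrite !derivE !hornerE.
Qed.

Lemma dderivDr G p u v : dderiv G p (u + v) = dderiv G p u + dderiv G p v.
Proof.
by rewrite -big_split; apply: eq_bigr => i _; rewrite /= mxE mulrDl.
Qed.

Lemma dderivZr G p c v : dderiv G p (c *: v) = c * dderiv G p v.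
Proof.
by rewrite big_distrr; apply: eq_bigr => i _; rewrite /= mxE mulrA.
Qed.

Lemma dderivZl d G p c v : G \is d.-homog -> dderiv G (c *: p) v =
  c ^+ d.-1 * dderiv G p v.
Proof.
move=> hG; rewrite big_distrr; apply: eq_bigr => i _ /=.
by rewrite (meval_homog _ _ (mderiv_homog i hG)) mulrCA.
Qed.

(** Euler's identity: along the line through [p] with direction [p], the form restricts to
    [(1 + s)^d G(p)]. *)
Lemma dderiv_euler d G p : G \is d.-homog -> dderiv G p p = d%:R * G.@[p 0].
Proof.
move=> hG; rewrite -deriv_line /line.
rewrite (eq_mmap (f2 := polyC) (h2 := fun i => (1 + 'X) * (p 0 i)%:P)) //;
  last first.
  by move=> i; rewrite mulrDl mul1r mulrC mul_polyC.
have -> : mmap polyC (fun i => (1 + 'X) * (p 0 i)%:P) G =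
  (1 + 'X) ^+ d * (G.@[p 0])%:P.
  rewrite (mmap_homog _ _ _ hG) /meval (rmorph_mmap _ polyC); congr (_ * _).
rewrite derivM derivC mulr0 addr0 deriv_exp !hornerE derivD derivX.
by rewrite derivC add0r mul1r hornerMn horner_exp !hornerE expr1n.
Qed.

Lemma dderiv_delta G p i : dderiv G p (delta_mx 0 i) = (G^`M(i)).@[p 0].
Proof.
rewrite /dderiv (bigD1 i) //= mxE !eqxx mul1r big1 ?addr0 // => j nij.
by rewrite mxE (negPf nij) andbF mul0r.
Qed.

End MpolyCalculusMore.

(** * Affine charts of a plane quartic *)

Lemma sum3 (V : nmodType) (f : 'I_3 -> V) : \sum_i f i = f 0 + f 1 + f 2.
Proof.
rewrite !big_ord_recr big_ord0 /= add0r.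
by congr (f _ + f _ + f _); apply: val_inj.
Qed.

Lemma ord3P (P : 'I_3 -> Prop) : P 0 -> P 1 -> P 2 -> forall i, P i.
Proof.
move=> P0 P1 P2 [[|[|[|//]]] lti].
- by have -> : Ordinal lti = 0 by apply: val_inj.
- by have -> : Ordinal lti = 1 by apply: val_inj.
- by have -> : Ordinal lti = 2 by apply: val_inj.
Qed.

Section Charts.

Variable K : closedFieldType.
Implicit Types (G : {mpoly K[3]}) (p v : 'rV[K]_3).

Section Chart.

Variable e : 'M[K]_3.

Definition pt (a b : K) : 'rV[K]_3 := row 0 e + a *: row 1 e + b *: row 2 e.

(** Dehomogenisation in the basis [e]. The inner variable is the coordinate along row 1 and the
    outer one that along row 2. *)
Definition chart G : {poly {poly K}} :=
  mmap (polyC \o polyC)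
    (fun i => ((e 0 i)%:P + e 1 i *: 'X)%:P + (e 2 i)%:P *: 'X) G.

Lemma chart_eval G a b : (fiber (chart G) a).[b] = G.@[pt a b 0].
Proof.
have -> : fiber (chart G) a = line (row 0 e + a *: row 1 e) (row 2 e) G.
  rewrite /fiber rmorph_mmap; apply: eq_mmap => [c|i] /=.
    by rewrite map_polyC /= /horner_eval hornerC.
  rewrite -[LHS]/(fiber _ a) fiberD fiberC fiberZ fiberX.
  by by rewrite !mxE !hornerE mulrC.
by rewrite horner_line.
Qed.

Lemma chartB G H : chart (G - H) = chart G - chart H.
Proof. exact: rmorphB. Qed.

Lemma chartZ c G : chart (c *: G) = c%:P *: chart G.
Proof. by rewrite /chart mmapZ /= mul_polyC. Qed.

(** The top coefficient is the value at the point [row 2 e]; normalising that value to 1 is what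
    makes the chart of the quartic monic. *)
Lemma chart_homog d G : G \is d.-homog ->
  (size (chart G) <= d.+1)%N /\ (chart G)`_d = (G.@[row 2 e 0])%:P.
Proof.
have topM (p q : {poly {poly K}}) i j : (size p <= i.+1)%N ->
  (size q <= j.+1)%N ->
    (size (p * q)%R <= (i + j).+1)%N /\ (p * q)`_(i + j) = p`_i * q`_j.
  move=> sp sq; split.
    apply: leq_trans (size_polyMleq _ _) _.
    by case: (size p) (size q) sp sq => [|m] [|m']; rewrite ?addn0 ?addnS //=;
      lia.
  rewrite coefM (bigD1 (inord i)) //= inordK ?addKn ?ltnS ?leq_addr // big1
    ?addr0 //.
  move=> k nki; have [lt_ki|lt_ik|eq_ki] := ltngtP k i.
  - by rewrite [q`__]nth_default ?mulr0 //; apply: leq_trans sq _; lia.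
  - by rewrite [p`__]nth_default ?mul0r //; apply: leq_trans sp _.
  by case/eqP: nki; apply: val_inj; rewrite /= inordK ?eq_ki // ltnS leq_addr.
move=> /dhomogP hG.
pose h i : {poly {poly K}} := ((e 0 i)%:P + e 1 i *: 'X)%:P + (e 2 i)%:P *: 'X.
have mono m : (size (mmap1 h m) <= (mdeg m).+1)%N /\
    (mmap1 h m)`_(mdeg m) =
    (\prod_i row 2 e 0 i ^+ m i)%:P.
  rewrite /mmap1 mdegE.
  elim/big_rec3: _ => [|i x y z _ [IHs IHc]]; first by rewrite size_poly1 coef1.
  set l := h i; have [sl cl] : (size l <= 2)%N /\ l`_1 = (row 2 e 0 i)%:P.
    split; last by rewrite /l /h coefD coefC coefZ coefX mulr1 add0r mxE.
    rewrite (leq_trans (size_polyD _ _)) // geq_max.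
    rewrite (leq_trans (size_polyC_leq1 _)) //.
    by rewrite (leq_trans (size_scale_leq _ _)) // size_polyX.
  have [sk ck] : (size (l ^+ m i) <= (m i).+1)%N /\
      (l ^+ m i)`_(m i) = (row 2 e 0 i ^+ m i)%:P.
    elim: (m i) => [|k [IHsk IHck]]; first by rewrite expr0 size_poly1 coef1.
    have [s c] := topM l _ 1%N k sl IHsk; rewrite exprS; split=> //.
    by rewrite [k.+1]/(1 + k)%N c cl IHck -polyCM -exprS.
  have [s c] := topM _ _ _ _ sk IHs.
  by split=> //; rewrite c ck IHc -polyCM.
split.
  apply: (leq_trans (size_sum _ _ _)); apply/bigmax_leqP_seq => m /hG /= dm _.
  by rewrite /= mul_polyC (leq_trans (size_scale_leq _ _)) // -dm;
    case: (mono m).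
rewrite coef_sum mevalE rmorph_sum /=; apply: eq_big_seq => m /hG /= dm.
by rewrite coefCM -[in LHS]dm; case: (mono m) => _ ->; rewrite -polyCM.
Qed.

(** The affine counterpart of [line]: [g] along the line through [(a, b)] with direction
    [(s, t)]. *)
Definition branch (a b s t : K) (g : {poly {poly K}}) : {poly K} :=
  (map_poly (comp_poly (a%:P + s *: 'X)) g).[b%:P + t *: 'X].

Lemma branchM a b s t f g :
  branch a b s t (f * g) = branch a b s t f * branch a b s t g.
Proof. by rewrite /branch rmorphM /= hornerM. Qed.

Lemma branch0 a b s t g : (branch a b s t g).[0] = (fiber g a).[b].
Proof.
rewrite /branch -/(horner_eval 0 _) -horner_map /= -map_poly_comp /horner_eval.
have -> : (b%:P + t *: 'X).[0] = b by rewrite !hornerE.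
congr (_.[_]); apply: eq_map_poly => p /=.
by rewrite /horner_eval horner_comp !hornerE.
Qed.

Lemma branch_chart a b s t G :
  branch a b s t (chart G) = line (pt a b) (s *: row 1 e + t *: row 2 e) G.
Proof.
rewrite /branch rmorph_mmap -/(horner_eval _ _) rmorph_mmap.
apply: eq_mmap => [c|i] /=.
  by rewrite map_polyC /= /horner_eval hornerC comp_polyC.
rewrite /horner_eval rmorphD /= map_polyC /= map_polyZ /= map_polyX !mxE.
rewrite !hornerE comp_polyC comp_polyD comp_polyC comp_polyZ comp_polyX.
rewrite -!mul_polyC !(polyCD, polyCM).
ring.
Qed.

Definition coords p : 'rV[K]_3 := p *m invmx e.

Hypothesis ue : e \in unitmx.

Lemma coordsE p : p = coords p 0 0 *: row 0 e + coords p 0 1 *: row 1 e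
                      + coords p 0 2 *: row 2 e.
Proof. by rewrite -[LHS](mulmxKV ue) mulmx_sum_row sum3. Qed.

Lemma pt_span a b v : let c := coords v in
  v = c 0 0 *: pt a b
      + ((c 0 1 - c 0 0 * a) *: row 1 e + (c 0 2 - c 0 0 * b) *: row 2 e).
Proof.
by move=> c; rewrite [LHS]coordsE -/c /pt; apply/rowP=> i; rewrite !mxE; ring.
Qed.

Lemma pt_neq0 a b : pt a b != 0.
Proof.
have Dpt : pt a b = \row_i nth 0 [:: 1; a; b] i *m e.
  by rewrite mulmx_sum_row sum3 !mxE /= scale1r.
apply/eqP=> pt0; have := congr1 (mulmx^~ (invmx e)) Dpt.
rewrite pt0 mul0mx mulmxK // => /rowP/(_ 0); rewrite !mxE /= => /esym/eqP.
by rewrite oner_eq0.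
Qed.

Lemma coords_pt p : coords p 0 0 != 0 ->
  p = coords p 0 0 *: pt (coords p 0 1 / coords p 0 0)
    (coords p 0 2 / coords p 0 0).
Proof.
move=> p0; rewrite [LHS]coordsE /pt !scalerDr !scalerA.
by rewrite !(mulrC (coords p 0 0)) !mulfVK.
Qed.

Lemma homog_vanish d G : G \is d.-homog ->
  (forall a b, G.@[pt a b 0] = 0) -> forall p, G.@[p 0] = 0.
Proof.
move=> hG G0 p.
have nz q : coords q 0 0 != 0 -> G.@[q 0] = 0.
  by move=> q0; rewrite (coords_pt q0) (meval_homog _ _ hG) G0 mulr0.
have [p0|] := eqVneq (coords p 0 0) 0; last exact: nz.
suff l0 : line p (row 0 e) G = 0.
  by rewrite -[p]addr0 -(scale0r (row 0 e)) -horner_line l0 horner0.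
(* The factor ['X] discards [s = 0], the only parameter at which the line leaves the chart. *)
suff : 'X * line p (row 0 e) G = 0.
  by move/eqP; rewrite mulf_eq0 polyX_eq0 => /eqP.
apply: vanish_poly_eq0 => s; rewrite hornerM hornerX horner_line.
have [->|s0] := eqVneq s 0; first by rewrite mul0r.
rewrite nz ?mulr0 // /coords mulmxDl mxE -/(coords p) p0 add0r -scalemxAl mxE.
by rewrite -row_mul mulmxV // !mxE eqxx mulr1.
Qed.

Variables (F : {mpoly K[3]}).
Hypothesis hF : F \is 4%N.-homog.
Hypothesis smF : forall p, p != 0 -> F.@[p 0] = 0 ->
  exists i, (F^`M(i)).@[p 0] != 0.
Hypothesis F1 : F.@[row 2 e 0] = 1.

Lemma size_chart : size (chart F) = 5%N.
Proof.
have [s c] := chart_homog hF; apply/eqP; rewrite eqn_leq s /= leqNgt.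
apply/negP=> /leq_sizeP/(_ 4%N (leqnn _)); rewrite c F1 => /eqP.
by rewrite polyC_eq0 oner_eq0.
Qed.

Lemma chart_monic : chart F \is monic.
Proof.
by rewrite monicE lead_coefE size_chart; case: (chart_homog hF) => _ ->;
  rewrite F1.
Qed.

(** At a common zero of two factors the product rule kills all derivatives in the directions of the
    chart, and Euler's identity the radial one, against smoothness. *)
Lemma chart_nonsing : nonsing (chart F).
Proof.
move=> Q R a b DF Qab Rab.
have F0 : F.@[pt a b 0] = 0 by rewrite -chart_eval DF fiberM hornerM Qab mul0r.
have dF0 s t : dderiv F (pt a b) (s *: row 1 e + t *: row 2 e) = 0.
  rewrite -deriv_line -branch_chart DF branchM derivM hornerD !hornerM !branch0.
  by rewrite Qab Rab mulr0 mul0r addr0.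
have dF v : dderiv F (pt a b) v = 0.
  rewrite (pt_span a b v) dderivDr dderivZr (dderiv_euler _ hF) F0 !mulr0 add0r.
  exact: dF0.
have [i] := smF (pt_neq0 a b) F0.
by rewrite -dderiv_delta dF eqxx.
Qed.

Lemma chart_multiple (G : {mpoly K[3]}) :
    (forall a b, a != 0 -> F.@[pt a b 0] = 0 -> G.@[pt a b 0] = 0) ->
  exists q, chart G = q * chart F.
Proof.
move=> GF; apply: (vanishing_multiple chart_monic chart_nonsing (e := 'X)).
  by rewrite polyX_eq0.
by move=> a b; rewrite hornerX !chart_eval; apply: GF.
Qed.

(** On the chart [G = q F], so on the curve the differential of [G] is [q] times that of [F]; the
    radial part of [v] is handled by Euler's identity. *)
Lemma chart_tangent G a b v : 
    (forall a b, F.@[pt a b 0] = 0 -> G.@[pt a b 0] = 0) ->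
    F.@[pt a b 0] = 0 -> dderiv F (pt a b) v = 0 ->
    forall d, G \is d.-homog -> dderiv G (pt a b) v = 0.
Proof.
move=> GF F0 dF d hG.
have [q Dq] : exists q, chart G = q * chart F.
  by apply: chart_multiple => a' b' _; apply: GF.
have dG s t : dderiv F (pt a b) (s *: row 1 e + t *: row 2 e) = 0 ->
    dderiv G (pt a b) (s *: row 1 e + t *: row 2 e) = 0.
  rewrite -!deriv_line -!branch_chart Dq branchM derivM hornerD !hornerM
    branch0.
  by rewrite chart_eval F0 mulr0 add0r => ->; rewrite mulr0.
move: dF; rewrite (pt_span a b v).
rewrite ![dderiv _ _ (_ + (_ + _))]dderivDr !(dderivZr _ _ _ (pt a b)).
rewrite (dderiv_euler _ hF) (dderiv_euler _ hG) F0 GF // !mulr0 !add0r.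
exact: dG.
Qed.

Lemma chart_vanish_small d G : G \is d.-homog -> (d < 4)%N ->
    (forall a b, a != 0 -> F.@[pt a b 0] = 0 -> G.@[pt a b 0] = 0) ->
  forall p, G.@[p 0] = 0.
Proof.
move=> hG d4 /chart_multiple[q Dq]; apply: (homog_vanish hG) => a b.
suff -> : G.@[pt a b 0] = (fiber (chart G) a).[b].
  suff q0 : q = 0 by rewrite Dq q0 mul0r /fiber rmorph0 horner0.
  have [s _] := chart_homog hG; apply: contraTeq s => q0.
  rewrite Dq size_Mmonic ?chart_monic // size_chart -ltnNge addnS /=.
  by apply: (leq_trans (n := 5)) => //; rewrite (leq_add2r 4 1) size_poly_gt0.
by rewrite chart_eval.
Qed.

Lemma chart_vanish4 G : G \is 4%N.-homog ->
    (forall a b, F.@[pt a b 0] = 0 -> G.@[pt a b 0] = 0) ->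
  exists c, forall p, G.@[p 0] = c * F.@[p 0].
Proof.
move=> hG GF; have [q Dq] : exists q, chart G = q * chart F.
  by apply: chart_multiple => a' b' _; apply: GF.
pose c := G.@[row 2 e 0]; exists c => p.
have [s cG] := chart_homog hG.
have sq : (size q <= 1)%N.
  have [->|q0] := eqVneq q 0; first by rewrite size_poly0.
  by move: s; rewrite Dq size_Mmonic ?chart_monic // size_chart addnS /=
    (leq_add2r 4 _ 1).
have {sq} q1 := size1_polyC sq.
have qc : q`_0 = c%:P.
  have [_ cF] := chart_homog hF; move: cG.
  by rewrite Dq q1 coefCM cF F1 mulr1 => ->; rewrite coefC.
have : (G - c *: F).@[p 0] = 0.
  apply: (homog_vanish (d := 4)) p => [|a b]; first by apply/rpredB/rpredZ.
  rewrite -chart_eval chartB chartZ Dq q1 qc mul_polyC subrr.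
  by rewrite /fiber rmorph0 horner0.
by rewrite mevalB mevalZ => /eqP; rewrite subr_eq0 => /eqP.
Qed.

End Chart.

End Charts.

(** * Forms and sections on a smooth quartic *)

Section SmoothQuartic.

Variables (K : closedFieldType) (F : {mpoly K[3]}).
Implicit Types (G : {mpoly K[3]}) (p q v : 'rV[K]_3).

Hypothesis hF : F \is 4%N.-homog.
Hypothesis smF : forall p, p != 0 -> F.@[p 0] = 0 ->
  exists i, (F^`M(i)).@[p 0] != 0.

(** If [F] vanishes at some point, a nonzero partial derivative there shows that [F] is not
    identically zero along a coordinate direction. *)
Lemma nonvanishing_point : exists p, F.@[p 0] != 0.
Proof.
pose p0 : 'rV[K]_3 := delta_mx 0 0.
have [F0|] := eqVneq (F.@[p0 0]) 0; last by exists p0.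
have [|i] := smF _ F0.
  by apply/eqP=> /matrixP/(_ 0 0)/eqP; rewrite !mxE oner_eq0.
rewrite -dderiv_delta -deriv_line => dl.
have [s] : exists s, (line p0 (delta_mx 0 i) F).[s] != 0.
  apply: poly_nonroot; apply: contraNneq dl => ->.
  by rewrite derivC horner0.
by rewrite horner_line => Fs; exists (p0 + s *: delta_mx 0 i).
Qed.

Definition normal_basis (e : 'M[K]_3) := e \in unitmx /\ F.@[row 2 e 0] = 1.

Lemma exists_normal_basis : exists e, normal_basis e.
Proof.
have [w Fw] := nonvanishing_point.
have w0 : w != 0.
  apply: contraNneq Fw => ->; rewrite -(scale0r 0) (meval_homog _ _ hF).
  by rewrite expr0n mul0r.
pose U := row_ebase w.
have [c Dw] : exists c, w = c *: row 0 U.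
  exists ((col_ebase w *m pid_mx (\rank w) : 'rV_3) 0 0).
  rewrite -[LHS]mulmx_ebase mulmx_sum_row (bigD1 0) //= big1 ?addr0 // => i i0.
  rewrite !mxE big_ord1 !mxE eq_sym.
  by rewrite -[_ == _ :> nat]/(i == 0) (negPf i0) /= mulr0 scale0r.
have FU : F.@[row 0 U 0] != 0.
  by apply: contraNneq Fw => FU; rewrite Dw (meval_homog _ _ hF) FU mulr0.
have [t Dt] : exists t : K, t ^+ 4 = (F.@[row 0 U 0])^-1.
  have [t Dt] := @solve_monicpoly K 4
    (fun i => if i == 0%N then (F.@[row 0 U 0])^-1 else 0) isT.
  exists t; rewrite Dt !big_ord_recr big_ord0 /= !mul0r !addr0 add0r.
  by rewrite expr0 mulr1.
exists (t *: xrow 0 2 U).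
have t0 : t != 0.
  by apply/eqP=> t0; move/eqP: Dt; rewrite t0 expr0n eq_sym invr_eq0 (negPf FU).
split.
  rewrite unitmxZ ?unitfE // /xrow row_permE unitmx_mul unitmx_perm.
  exact: row_ebase_unit.
have -> : row 2 (t *: xrow 0 2 U) = t *: row 0 U.
  by apply/rowP=> i; rewrite !mxE tpermR.
by rewrite (meval_homog _ _ hF) Dt mulVf.
Qed.

(** The charts of [e] and [swap01 e] together miss only the point [row 2 e], which is off the curve
    for a normal basis. *)
Definition swap01 (e : 'M[K]_3) := xrow 0 1 e.

Lemma normal_basis_swap e : normal_basis e -> normal_basis (swap01 e).
Proof.
case=> ue Fe; split.
  by rewrite /swap01 /xrow row_permE unitmx_mul unitmx_perm.
have -> : row 2 (swap01 e) = row 2 e by apply/rowP=> i; rewrite !mxE tpermD.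
exact: Fe.
Qed.

Lemma pt_swapE e a b :
  pt (swap01 e) a b = row 1 e + a *: row 0 e + b *: row 2 e.
Proof.
by apply/rowP=> i; rewrite !mxE tpermL tpermR tpermD.
Qed.

Lemma pt_swap e a b : a != 0 -> pt e a b = a *: pt (swap01 e) a^-1 (b / a).
Proof.
move=> a0; rewrite pt_swapE; apply/rowP=> i; rewrite !mxE; field.
exact: a0.
Qed.

Lemma curve_cover e p : normal_basis e -> p != 0 -> F.@[p 0] = 0 ->
  exists c a b, c != 0 /\ (p = c *: pt e a b \/ p = c *: pt (swap01 e) a b).
Proof.
move=> [ue Fe] p0 Fp; have [c0|c0] := eqVneq (coords e p 0 0) 0; last first.
  by exists (coords e p 0 0); do 2!eexists; split=> //; left; apply: coords_pt.
have Dp := coordsE ue p; rewrite c0 scale0r add0r in Dp.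
set y := coords e p 0 1 in Dp; set z := coords e p 0 2 in Dp.
have [y0|y0] := eqVneq y 0.
  rewrite Dp y0 scale0r add0r (meval_homog _ _ hF) Fe mulr1 in Fp.
  move/eqP: Fp; rewrite expf_eq0 /= => /eqP z0.
  by rewrite Dp y0 z0 !scale0r addr0 eqxx in p0.
exists y, 0, (z / y); split=> //; right.
by rewrite pt_swapE scale0r addr0 Dp scalerDr scalerA mulrC mulfVK.
Qed.

Definition vanishes G := forall p, p != 0 -> F.@[p 0] = 0 -> G.@[p 0] = 0.

Lemma tangent_vanish d G p v : G \is d.-homog -> vanishes G ->
  p != 0 -> F.@[p 0] = 0 -> dderiv F p v = 0 -> dderiv G p v = 0.
Proof.
move=> hG GF p0 Fp dFp; have [e ne] := exists_normal_basis.
have chart_case e' c a b : normal_basis e' -> c != 0 -> p = c *: pt e' a b ->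
    dderiv G p v = 0.
  move=> [ue Fe] c0 Dp; rewrite Dp (dderivZl _ _ _ hG).
  rewrite Dp (meval_homog _ _ hF) in Fp; rewrite Dp (dderivZl _ _ _ hF) in dFp.
  rewrite (chart_tangent ue hF smF Fe _ _ _ hG) ?mulr0 // => [a' b' Fab||].
  - by apply: GF => //; apply: pt_neq0.
  - by move/eqP: Fp; rewrite mulf_eq0 expf_eq0 /= (negPf c0) => /eqP.
  by move/eqP: dFp; rewrite mulf_eq0 expf_eq0 /= (negPf c0) => /eqP.
have [c [a [b [c0 [Dp|Dp]]]]] := curve_cover ne p0 Fp.
  exact: chart_case Dp.
exact: chart_case (normal_basis_swap ne) c0 Dp.
Qed.

Lemma small_vanish d G : G \is d.-homog -> (d < 4)%N -> vanishes G ->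
  forall p, G.@[p 0] = 0.
Proof.
move=> hG d4 GF; have [e [ue Fe]] := exists_normal_basis.
apply: (chart_vanish_small ue hF smF Fe hG d4) => a b _; apply: GF.
exact: pt_neq0.
Qed.

Lemma quartic_vanish G : G \is 4%N.-homog -> vanishes G ->
  exists c, forall p, G.@[p 0] = c * F.@[p 0].
Proof.
move=> hG GF; have [e [ue Fe]] := exists_normal_basis.
apply: (chart_vanish4 ue hF smF Fe hG) => a b; apply: GF.
exact: pt_neq0.
Qed.

(** * Regular sections of degree 1 are linear forms *)

Section LinearSection.

Variable s : 'rV[K]_3 -> K.
Hypothesis sZ : forall c p, c != 0 -> p != 0 -> F.@[p 0] = 0 -> s (c *: p) =
  c * s p.
Hypothesis s_reg : forall p, p != 0 -> F.@[p 0] = 0 ->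
  exists N D : {mpoly K[3]}, D.@[p 0] != 0 /\
    forall q, q != 0 -> F.@[q 0] = 0 -> D.@[q 0] * s q = N.@[q 0].

(** The denominators of [s] on the chart form an ideal without zeros on the curve, so 1 is a
    denominator; division by the monic quartic then bounds the degree. *)
Lemma section_poly e : normal_basis e ->
  exists n : {poly {poly K}}, (size n <= 4)%N /\
    forall a b, F.@[pt e a b 0] = 0 -> s (pt e a b) = (fiber n a).[b].
Proof.
move=> [ue Fe]; have mf := chart_monic hF Fe.
pose J (g : {poly {poly K}}) := exists n : {poly {poly K}}, forall a b,
  F.@[pt e a b 0] = 0 -> (fiber g a).[b] * s (pt e a b) = (fiber n a).[b].
have [n1 Dn1] : J 1.
  apply: (affine_ideal_unit mf).
  - by rewrite (size_chart hF Fe).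
  - exists 0 => a b Fab; rewrite chart_eval Fab mul0r.
    by rewrite /fiber rmorph0 horner0.
  - move=> g h [n Dn] [m Dm]; exists (n + m) => a b Fab.
    by rewrite !fiberD !hornerD mulrDl Dn ?Dm.
  - move=> u g [n Dn]; exists (u * n) => a b Fab.
    by rewrite !fiberM !hornerM -mulrA Dn.
  move=> a b; rewrite chart_eval => Fab.
  have [N [D [Dab DN]]] := s_reg (pt_neq0 ue a b) Fab.
  exists (chart e D); split; last by rewrite chart_eval.
  exists (chart e N) => a' b' Fab'; rewrite !chart_eval; apply: DN => //.
  exact: pt_neq0.
exists (Pdiv.Ring.rmodp n1 (chart e F)); split.
  by rewrite -ltnS -(size_chart hF Fe) Pdiv.Ring.ltn_rmodp monic_neq0.
move=> a b Fab; have := Dn1 a b Fab.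
rewrite {1}/fiber rmorph1 hornerC mul1r => ->.
rewrite [in LHS](Pdiv.RingMonic.rdivp_eq mf n1) fiberD fiberM hornerD hornerM.
by rewrite chart_eval Fab mulr0 add0r.
Qed.

(* The two charts express s by polynomials n and n' with                      *)
(* n(t, z) = t n'(1/t, z/t) on the curve, hence identically since both have   *)
(* degree less than 4 in z; this bounds the degrees in t.                     *)
Lemma section_affine e : normal_basis e ->
  exists x y z, forall a b, F.@[pt e a b 0] = 0 ->
    s (pt e a b) = x + y * a + z * b.
Proof.
move=> ne; have [ue Fe] := ne.
have [n [sn Dn]] := section_poly ne.
have [n' [sn' Dn']] := section_poly (normal_basis_swap ne).
pose c i : {poly K} := n`_i; pose c' i : {poly K} := n'`_i.
pose m := (\max_(i < 4) size (c' i))%N.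
have le_m i : (i < 4)%N -> (size (c' i) <= m.+1)%N.
  by move=> lti; rewrite leqW // (leq_bigmax (Ordinal lti)).
pose r i : {poly K} := \poly_(j < m.+1) (c' i)`_(m - j).
have rE i a : (i < 4)%N -> a != 0 -> (r i).[a] = a ^+ m * (c' i).[a^-1].
  move=> lti a0; rewrite horner_poly (horner_coef_wide _ (le_m i lti))
    big_distrr /=.
  rewrite (reindex_inj rev_ord_inj) /=; apply: eq_bigr => j _.
  have ltj := ltn_ord j.
  have -> : (m - (m.+1 - j.+1) = j)%N by lia.
  rewrite mulrCA; congr (_ * _).
  have -> : a ^+ m = a ^+ (m.+1 - j.+1) * a ^+ j by rewrite -exprD;
    congr (_ ^+ _); lia.
  by rewrite -mulrA exprVn mulfV ?mulr1 // expf_neq0.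
have fE (g : {poly {poly K}}) a b : (size g <= 4)%N ->
    (fiber g a).[b] = \sum_(i < 4) (g`_i).[a] * b ^+ i.
  move=> sg; rewrite (@horner_coef_wide _ 4).
    by apply: eq_bigr => i _; rewrite coef_map.
  by apply: leq_trans sg; apply: size_poly.
(* This is [n(t, z) - t n'(1/t, z/t)] cleared of denominators by [t^(m + 3)]; [r i] is [t^m] times
   [c' i] at [1/t]. *)
pose h : {poly {poly K}} := \poly_(i < 4) ('X^(m + 3) * c i - 'X^(4 - i) * r i).
have h0 : h = 0.
  apply: (vanishing_small_eq0 (chart_monic hF Fe) (chart_nonsing ue hF smF)
    (e := 'X)).
  - by rewrite polyX_eq0.
  - move=> a b; rewrite hornerX chart_eval => a0 Fab.
    have sh : (size h <= 4)%N by apply: size_poly.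
    have := Dn a b Fab; have Fab' := Fab; rewrite (pt_swap e b a0) in Fab' *.
    rewrite (meval_homog _ _ hF) in Fab'.
    have {}Fab' : F.@[pt (swap01 e) a^-1 (b / a) 0] = 0.
      by move/eqP: Fab'; rewrite mulf_eq0 expf_eq0 /= (negPf a0) => /eqP.
    rewrite sZ //; last exact/pt_neq0/(normal_basis_swap ne).1.
    rewrite Dn' // !fE // => E.
    transitivity (a ^+ (m + 3) * \sum_(i < 4) (n`_i).[a] * b ^+ i
        - a ^+ (m + 3) * (a * \sum_(i < 4) (n'`_i).[a^-1] * (b / a) ^+ i)).
      rewrite !big_distrr /= -sumrB; apply: eq_bigr => i _.
      rewrite coef_poly ltn_ord hornerD hornerN !hornerM !hornerXn rE //.
      rewrite mulrBl -/(c i) -/(c' i); congr (_ - _); first by rewrite mulrA.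
      rewrite expr_div_n (exprD a m) -!mulrA mulrCA; congr (_ * _).
      have -> : a * (a * (a * (a * ((c' i).[a^-1] * (b ^+ i / a ^+ i))))) =
                (a ^+ 4 / a ^+ i) * ((c' i).[a^-1] * b ^+ i) by ring.
      have lti := ltn_ord i.
      have -> : a ^+ 4 = a ^+ (4 - i) * a ^+ i.
        by rewrite -exprD; congr (_ ^+ _); lia.
      by rewrite mulfK ?expf_neq0.
    by rewrite E subrr.
  by rewrite (size_chart hF Fe) ltnS size_poly.
(* From [h = 0], [m + 3 + deg (c i) = 4 - i + deg (r i)] for nonzero [c i], and [deg (r i) <= m];
   hence [deg (c i) <= 1 - i]. *)
have ci i : (i < 4)%N -> (size (c i) <= 2 - i)%N.
  move=> lti; have : h`_i = 0 by rewrite h0 coef0.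
  rewrite coef_poly lti => /eqP; rewrite subr_eq0 => /eqP E.
  have sr : (size (r i) <= m.+1)%N by apply: size_poly.
  have [->|c0] := eqVneq (c i) 0; first by rewrite size_poly0.
  have r0 : r i != 0.
    apply: contraNneq c0 => r0; move/eqP: E; rewrite r0 mulr0 mulf_eq0.
    by rewrite (negPf (monic_neq0 (monicXn _ _))).
  have := congr1 (fun p : {poly K} => size p) E.
  rewrite /= !size_monicM ?monicXn // !size_polyXn.
  move: c0 r0 sr; rewrite -!size_poly_gt0.
  by move: (size (r i)) (size (c i)) => x y; clear -lti; lia.
exists (c 0%N)`_0, (c 0%N)`_1, (c 1%N)`_0 => a b Fab.
rewrite Dn // fE // !big_ord_recr big_ord0 /= add0r.
rewrite -/(c 0%N) -/(c 1%N) -/(c 2) -/(c 3).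
have -> : c 2 = 0 by apply/eqP; rewrite -size_poly_leq0 (ci 2).
have -> : c 3 = 0 by apply/eqP; rewrite -size_poly_leq0 (ci 3).
rewrite (horner_coef_wide a (ci 0%N isT)) (horner_coef_wide a (ci 1%N isT)).
by rewrite !big_ord_recr !big_ord0 /= horner0 !mul0r; ring.
Qed.

(** Each of the two charts gives an affine expression of [s]. Their difference on the overlap has
    degree at most 1 in the monic variable, hence is zero, so the coefficients match and define one
    linear form. *)
Lemma linear_section : exists l : 'cV[K]_3,
  forall q, q != 0 -> F.@[q 0] = 0 -> s q = (q *m l) 0 0.
Proof.
have [e ne] := exists_normal_basis; have [ue Fe] := ne.
have ne' := normal_basis_swap ne.
have [x [y [z Ds]]] := section_affine ne.
have [x' [y' [z' Ds']]] := section_affine ne'.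
pose R : {poly {poly K}} :=
  ((x - y')%:P + (y - x') *: 'X)%:P + (z - z')%:P *: 'X.
have R0 : R = 0.
  apply: (vanishing_small_eq0 (chart_monic hF Fe) (chart_nonsing ue hF smF)
    (e := 'X)).
  - by rewrite polyX_eq0.
  - move=> a b; rewrite hornerX chart_eval => a0 Fab.
    have := Ds a b Fab; have Fab' := Fab; rewrite (pt_swap e b a0) in Fab' *.
    rewrite (meval_homog _ _ hF) in Fab'.
    have {}Fab' : F.@[pt (swap01 e) a^-1 (b / a) 0] = 0.
      by move/eqP: Fab'; rewrite mulf_eq0 expf_eq0 /= (negPf a0) => /eqP.
    rewrite sZ ?Ds' //; last exact/pt_neq0/ne'.1.
    move=> E; rewrite /R fiberD fiberC fiberZ fiberX !hornerE.
    have -> : x - y' + (y - x') * a + (z - z') * b =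
      (x + y * a + z * b) - a * (x' + y' * a^-1 + z' * (b / a)) by field;
        exact: a0.
    by rewrite E subrr.
  rewrite (size_chart hF Fe) ltnS (leq_trans (size_polyD _ _)) // geq_max.
  rewrite (leq_trans (size_polyC_leq1 _)) //.
  by rewrite (leq_trans (size_scale_leq _ _)) // size_polyX.
have Ez : z' = z.
  have := congr1 (fun g : {poly {poly K}} => g`_1) R0.
  rewrite /R coefD coefC coefZ coefX mulr1 coef0 add0r => /polyC_inj/eqP.
  by rewrite subr_eq0 => /eqP.
have R00 : (x - y')%:P + (y - x') *: 'X = 0.
  have := congr1 (fun g : {poly {poly K}} => g`_0) R0.
  by rewrite /R coefD coefC coefZ coefX mulr0 coef0 addr0.
have Ey : y' = x.
  have := congr1 (fun g : {poly K} => g`_0) R00.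
  rewrite coefD coefC coefZ coefX mulr0 coef0 addr0 => /eqP.
  by rewrite subr_eq0 => /eqP.
have Ex : x' = y.
  have := congr1 (fun g : {poly K} => g`_1) R00.
  rewrite coefD coefC coefZ coefX mulr1 coef0 add0r => /eqP.
  by rewrite subr_eq0 => /eqP.
pose u : 'cV[K]_3 := \col_i nth 0 [:: x; y; z] i.
have rowl k : (row k e *m (invmx e *m u)) 0 0 = u k 0.
  by rewrite -row_mul mulKVmx // mxE.
exists (invmx e *m u) => q q0 Fq.
have [c [a [b [c0 Dq]]]] := curve_cover ne q0 Fq.
have Fpt p : q = c *: p -> F.@[p 0] = 0.
  move=> Dqp; move: Fq; rewrite Dqp (meval_homog _ _ hF) => /eqP.
  by rewrite mulf_eq0 expf_eq0 /= (negPf c0) => /eqP.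
case: Dq => Dq; have Fab := Fpt _ Dq; rewrite Dq.
  rewrite sZ ?Ds //; last exact: pt_neq0.
  rewrite /pt -!scalemxAl !mulmxDl -!scalemxAl [in RHS]mxE.
  rewrite ![(_ + _ : 'M_(_, _)) 0 0]mxE ![(_ *: _ : 'M_(_, _)) 0 0]mxE !rowl
    !mxE /=.
  by ring.
rewrite sZ ?Ds' //; last exact/pt_neq0/ne'.1.
rewrite pt_swapE -!scalemxAl !mulmxDl -!scalemxAl [in RHS]mxE.
rewrite ![(_ + _ : 'M_(_, _)) 0 0]mxE ![(_ *: _ : 'M_(_, _)) 0 0]mxE !rowl !mxE
  /=.
by rewrite Ex Ey Ez; ring.
Qed.

End LinearSection.

End SmoothQuartic.

(** * Automorphisms of smooth quartics are linear *)

Section CrossProduct.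

(** Stated for functions into any commutative ring, so as to apply to triples of forms as well as to
    vectors. *)
Definition crossf (R : comNzRingType) (u w : 'I_3 -> R) (i : 'I_3) : R :=
  nth 0 [:: u 1 * w 2 - u 2 * w 1; u 2 * w 0 - u 0 * w 2; u 0 * w 1 - u 1 * w 0]
    i.

Lemma rmorph_crossf (R S : comNzRingType) (f : {rmorphism R -> S}) u w i :
  f (crossf u w i) = crossf (f \o u) (f \o w) i.
Proof. by elim/ord3P: i; rewrite /crossf /= rmorphB !rmorphM. Qed.

Variable K : fieldType.
Implicit Types (u v w : 'rV[K]_3).

Definition cross u w : 'rV[K]_3 := \row_i crossf (u 0) (w 0) i.

Definition dot u w : K := \sum_i u 0 i * w 0 i.

Lemma crossE u w : [/\ cross u w 0 0 = u 0 1 * w 0 2 - u 0 2 * w 0 1,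
  cross u w 0 1 = u 0 2 * w 0 0 - u 0 0 * w 0 2 &
  cross u w 0 2 = u 0 0 * w 0 1 - u 0 1 * w 0 0].
Proof. by rewrite !mxE. Qed.

Lemma row3P u w : u 0 0 = w 0 0 -> u 0 1 = w 0 1 -> u 0 2 = w 0 2 -> u = w.
Proof. by move=> e0 e1 e2; apply/rowP; elim/ord3P. Qed.

Lemma row3_neq0 u : u != 0 -> exists i, u 0 i != 0.
Proof.
move=> u0; apply/existsP; apply: contraNT u0.
by rewrite negb_exists => /forallP u0; apply/eqP/rowP=> i; rewrite mxE;
  apply/eqP/negPn.
Qed.

Lemma cross_eq0P u w : u != 0 -> cross u w = 0 -> exists c, w = c *: u.
Proof.
move=> /row3_neq0[i ui] uw; exists (w 0 i / u 0 i).
have [] := crossE u w; rewrite uw !mxE => /esym e0 /esym e1 /esym e2.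
suff E j : w 0 j * u 0 i = w 0 i * u 0 j.
  by apply/rowP=> j; rewrite mxE mulrAC -E mulfK.
by move: {ui} i j; elim/ord3P; elim/ord3P => //; apply/eqP; rewrite -subr_eq0;
  apply/eqP; first [rewrite -e0; ring | rewrite -e1; ring | rewrite -e2; ring
                   | rewrite -[RHS]oppr0 -e0; ring | rewrite -[RHS]oppr0 -e1;
                     ring
                   | rewrite -[RHS]oppr0 -e2; ring].
Qed.

(** By the triple product formula [n x (u x w) = (w . n) u - (u . n) w = 0]. *)
Lemma cross_normal n u w : n != 0 -> dot u n = 0 -> dot w n = 0 ->
  exists c, cross u w = c *: n.
Proof.
rewrite /dot !sum3 => n0 un wn; apply: cross_eq0P => //.
have [e0 e1 e2] := crossE u w.
have [f0 f1 f2] := crossE n (cross u w).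
apply: row3P; rewrite [RHS]mxE.
- transitivity (u 0 0 * (w 0 0 * n 0 0 + w 0 1 * n 0 1 + w 0 2 * n 0 2)
      - w 0 0 * (u 0 0 * n 0 0 + u 0 1 * n 0 1 + u 0 2 * n 0 2)).
    by rewrite f0 e1 e2; ring.
  by rewrite un wn !mulr0 subrr.
- transitivity (u 0 1 * (w 0 0 * n 0 0 + w 0 1 * n 0 1 + w 0 2 * n 0 2)
      - w 0 1 * (u 0 0 * n 0 0 + u 0 1 * n 0 1 + u 0 2 * n 0 2)).
    by rewrite f1 e0 e2; ring.
  by rewrite un wn !mulr0 subrr.
transitivity (u 0 2 * (w 0 0 * n 0 0 + w 0 1 * n 0 1 + w 0 2 * n 0 2)
    - w 0 2 * (u 0 0 * n 0 0 + u 0 1 * n 0 1 + u 0 2 * n 0 2)).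
  by rewrite f2 e0 e1; ring.
by rewrite un wn !mulr0 subrr.
Qed.

(* The case [w] = [e_n] of [q x (g x w) = (q . w) g - (q . g) w]. *)
Lemma cross_delta q g n : dot q g = 0 ->
  cross q (cross g (delta_mx 0 n)) = q 0 n *: g.
Proof.
rewrite /dot sum3 => qg.
by move: n; elim/ord3P; apply: row3P;
  rewrite !mxE /crossf /= !mxE /crossf /= !mxE /=;
  apply/eqP; rewrite -subr_eq0; apply/eqP;
  first [ring | rewrite -[RHS]oppr0 -qg; ring].
Qed.

Lemma crossZZ a b u w : cross (a *: u) (b *: w) = (a * b) *: cross u w.
Proof. by apply: row3P; rewrite !mxE /crossf /= !mxE; ring. Qed.

Lemma crossZr b u w : cross u (b *: w) = b *: cross u w.
Proof. by rewrite -{1}[u]scale1r crossZZ mul1r. Qed.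

Lemma crossDr u w v : cross u (w + v) = cross u w + cross u v.
Proof. by apply: row3P; rewrite !mxE /crossf /= !mxE; ring. Qed.

Lemma cross_self u : cross u u = 0.
Proof. by apply: row3P; rewrite !mxE /crossf /=; ring. Qed.

Lemma dot_cross_r u w : dot w (cross u w) = 0.
Proof. by rewrite /dot sum3 !mxE /crossf /=; ring. Qed.

End CrossProduct.

(** * Regular maps and the pull-back of the canonical map *)

Section RegularMaps.

Variables (K : closedFieldType) (F : {mpoly K[3]}).
Implicit Types (G : {mpoly K[3]}) (p q r v : 'rV[K]_3).

Definition forms (P : 'I_3 -> {mpoly K[3]}) p : 'rV[K]_3 := \row_i (P i).@[p 0].

Definition dforms (P : 'I_3 -> {mpoly K[3]}) p v : 'rV[K]_3 :=
  \row_i dderiv (P i) p v.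

Definition grad p : 'rV[K]_3 := \row_i (F^`M(i)).@[p 0].

Definition oncurve p := p != 0 /\ F.@[p 0] = 0.

Lemma forms_homog d P c p : (forall i, P i \is d.-homog) ->
  forms P (c *: p) = c ^+ d *: forms P p.
Proof. by move=> hP; apply/rowP=> i; rewrite !mxE (meval_homog _ _ (hP i)). Qed.

Lemma dderivZZ d G c p v : G \is d.-homog -> dderiv G (c *: p) (c *: v) =
  c ^+ d * dderiv G p v.
Proof.
move=> hG; rewrite -!deriv_line.
suff -> : line (c *: p) (c *: v) G = (c ^+ d)%:P * line p v G.
  by rewrite derivM derivC mul0r add0r hornerM hornerC.
rewrite polyC_exp -mmap_homog //; apply: eq_mmap => // i.
by rewrite !mxE mulrDr !polyCM -!mul_polyC polyCM mulrA.
Qed.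

Lemma parallelP p q : q != 0 -> (p == q)%MS -> exists2 c, c != 0 & p = c *: q.
Proof.
move=> q0 /andP[/sub_rVP[c Dp] qp]; exists c => //.
apply: contraNneq q0 => c0; rewrite -submx0; apply: submx_trans qp _.
by rewrite Dp c0 scale0r sub0mx.
Qed.

Lemma parallelZ c q : c != 0 -> (c *: q == q)%MS.
Proof. by move=> c0; apply/eqmxP/eqmx_scale. Qed.

Lemma parallel_sym p q : (p == q)%MS -> (q == p)%MS.
Proof. by rewrite andbC. Qed.

Lemma parallel_trans p q r : (p == q)%MS -> (q == r)%MS -> (p == r)%MS.
Proof. by move=> /eqmxP pq /eqmxP qr; apply/eqmxP/(eqmx_trans pq qr). Qed.

Hypothesis hF : F \is 4%N.-homog.
Hypothesis smF : forall p, p != 0 -> F.@[p 0] = 0 ->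
  exists i, (F^`M(i)).@[p 0] != 0.

Lemma oncurveZ c p : c != 0 -> oncurve p -> oncurve (c *: p).
Proof.
move=> c0 [p0 Fp]; split; first by rewrite scaler_eq0 negb_or c0.
by rewrite (meval_homog _ _ hF) Fp mulr0.
Qed.

Lemma oncurve_par p q : p != 0 -> oncurve q -> (p == q)%MS -> oncurve p.
Proof. by move=> p0 Cq /(parallelP Cq.1)[c c0 ->]; apply: oncurveZ. Qed.

Lemma grad_neq0 p : oncurve p -> grad p != 0.
Proof.
case=> p0 /(smF p0)[i]; apply: contraNneq => /rowP/(_ i).
by rewrite !mxE => ->.
Qed.

Lemma gradZ c p : grad (c *: p) = c ^+ 3 *: grad p.
Proof.
by apply/rowP=> i; rewrite !mxE (meval_homog _ _ (mderiv_homog i hF)).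
Qed.

Lemma dderiv_dot p v : dderiv F p v = dot v (grad p).
Proof. by apply: eq_bigr => i _; rewrite mxE. Qed.

Lemma dot_grad p : oncurve p -> dot p (grad p) = 0.
Proof. by case=> _ Fp; rewrite -dderiv_dot (dderiv_euler _ hF) Fp mulr0. Qed.

Lemma tangent_exists q : oncurve q -> exists v, cross q v = grad q.
Proof.
move=> Cq; have [n qn] := row3_neq0 Cq.1.
exists ((q 0 n)^-1 *: cross (grad q) (delta_mx 0 n)).
rewrite crossZr (cross_delta _ (dot_grad Cq)).
by rewrite scalerA mulVf // scale1r.
Qed.

Lemma dderiv_tangent q v : cross q v = grad q -> dderiv F q v = 0.
Proof. by move=> Dg; rewrite dderiv_dot -Dg dot_cross_r. Qed.

Lemma tangent_unique q v w : oncurve q -> cross q v = grad q ->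
  cross q w = grad q -> exists c, w = v + c *: q.
Proof.
move=> [q0 _] vg wg; have [c Dc] : exists c, w - v = c *: q.
  by apply: cross_eq0P => //;
    rewrite crossDr wg -scaleN1r crossZr vg scaleN1r subrr.
by exists c; rewrite -Dc addrC subrK.
Qed.

Definition represents (s : 'rV[K]_3 -> 'rV[K]_3) d P :=
  (forall i, P i \is d.-homog) /\
  forall q, oncurve q -> forms P q != 0 -> (s q == forms P q)%MS.

Definition regular s := (forall p, oncurve p -> oncurve (s p)) /\
  forall p, oncurve p -> exists d P, represents s d P /\ forms P p != 0.

Lemma regular_par s p q : regular s -> oncurve p -> (p == q)%MS -> q != 0 -> 
  (s p == s q)%MS.
Proof.
move=> [_ rs] Cp pq q0; have [d [P [[hP sP] Pp]]] := rs p Cp.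
have [c c0 Dq] := parallelP Cp.1 (parallel_sym pq).
have Pq : (forms P q == forms P p)%MS.
  by rewrite Dq (forms_homog _ _ hP); apply: parallelZ; rewrite expf_neq0.
have Pq0 : forms P q != 0.
  by rewrite Dq (forms_homog _ _ hP) scaler_eq0 negb_or expf_neq0.
apply: (parallel_trans (sP p Cp Pp)); apply: (parallel_trans (parallel_sym Pq)).
apply: parallel_sym; apply: sP => //; exact: oncurve_par (parallel_sym pq).
Qed.

Lemma eval_comp (P : 'I_3 -> {mpoly K[3]}) G p :
  (mmap (@mpolyC 3 K) P G).@[p 0] = G.@[forms P p 0].
Proof.
rewrite {1}/meval rmorph_mmap; apply: eq_mmap => [c|i] /=; first exact: mevalC.
by rewrite mxE.
Qed.

Lemma dderiv_forms_comp (P : 'I_3 -> {mpoly K[3]}) G p v :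
  dderiv (mmap (@mpolyC 3 K) P G) p v = dderiv G (forms P p) (dforms P p v).
Proof. exact: dderiv_comp. Qed.

Section Automorphisms.

Variables s t : 'rV[K]_3 -> 'rV[K]_3.
Hypotheses (rs : regular s) (rt : regular t).
Hypothesis tsK : forall p, oncurve p -> (t (s p) == p)%MS.
Hypothesis stK : forall p, oncurve p -> (s (t p) == p)%MS.

Lemma forms_oncurve d P q : represents s d P -> oncurve q -> forms P q != 0 ->
  oncurve (forms P q).
Proof.
move=> [_ sP] Cq P0; apply: oncurve_par (parallel_sym (sP q Cq P0)) => //.
exact: (proj1 rs).
Qed.

Lemma tangent_vanish_curve d G p v : G \is d.-homog ->
    (forall q, oncurve q -> G.@[q 0] = 0) -> oncurve p ->
  cross p v = grad p -> dderiv G p v = 0.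
Proof.
move=> hG GF [p0 Fp] pv; apply: (tangent_vanish hF smF hG) => //.
  by move=> q q0 Fq; apply: GF.
exact: dderiv_tangent.
Qed.

(** [F] composed with [P] vanishes on the curve, so the differential of [P] takes tangents to
    tangents: both factors of the cross product are orthogonal to the gradient at [P(q)]. *)
Lemma dforms_tangent d P q v : represents s d P -> oncurve q ->
  forms P q != 0 -> cross q v = grad q ->
  exists c, cross (forms P q) (dforms P q v) = c *: grad (forms P q).
Proof.
move=> rP Cq P0 qv; have Cx := forms_oncurve rP Cq P0.
apply: cross_normal; first exact: grad_neq0.
  exact: dot_grad.
rewrite -dderiv_dot -dderiv_forms_comp.
apply: (tangent_vanish_curve (comp_homog rP.1 hF)) => // p Cp.
rewrite eval_comp; have [->|Pp] := eqVneq (forms P p) 0.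
  by rewrite -(scale0r 0) (meval_homog _ _ hF) expr0n mul0r.
exact: (forms_oncurve rP Cp Pp).2.
Qed.

(* Two local expressions of the same map, with x = h x0, have derivatives     *)
(* that agree up to h and a multiple of x0, so the cross product scales by    *)
(* h ^ 2.                                                                     *)
Lemma cross_dforms_scale d0 P0 d P q v h : represents s d0 P0 ->
    represents s d P -> oncurve q -> forms P0 q != 0 -> forms P q != 0 ->
    cross q v = grad q -> forms P q = h *: forms P0 q ->
  cross (forms P q) (dforms P q v) =
    h ^+ 2 *: cross (forms P0 q) (dforms P0 q v).
Proof.
move=> r0 r Cq x0 x qv Dx.
have [k Dk] : exists k, dforms P q v - h *: dforms P0 q v = k *: forms P0 q.
  apply: cross_eq0P => //.
  have T i j : dforms P q v 0 i * forms P0 q 0 j +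
    forms P q 0 i * dforms P0 q v 0 j
      = dforms P q v 0 j * forms P0 q 0 i + forms P q 0 j * dforms P0 q v 0 i.
    have : dderiv (P i * P0 j - P j * P0 i) q v = 0.
      apply: (@tangent_vanish_curve (d + d0)) => // [|p Cp].
        by apply: rpredB; apply: dhomogM;
          [exact: r.1|exact: r0.1|exact: r.1|exact: r0.1].
      rewrite mevalB !mevalM.
      have E (H : 'I_3 -> {mpoly K[3]}) l : (H l).@[p 0] = forms H p 0 l by
        rewrite mxE.
      rewrite !E; have [->|x0p] := eqVneq (forms P0 p) 0.
        by rewrite !mxE !mulr0 subrr.
      have [->|xp] := eqVneq (forms P p) 0; first by rewrite !mxE !mul0r subrr.
      have := parallel_trans (parallel_sym (r0.2 p Cp x0p)) (r.2 p Cp xp).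
      move/(parallelP xp) => [c _ ->].
      by rewrite !mxE; ring.
    rewrite dderivB !dderivM => /eqP; rewrite subr_eq0 => /eqP.
    by rewrite !mxE.
  rewrite Dx in T.
  have := T 2 1; have := T 0 2; have := T 1 0; rewrite !mxE => T01 T20 T12.
  apply: row3P; rewrite !mxE /crossf /= !mxE.
  - by move/eqP: T12; rewrite -subr_eq0 => /eqP T12; rewrite -[RHS]T12; ring.
  - by move/eqP: T20; rewrite -subr_eq0 => /eqP T20; rewrite -[RHS]T20; ring.
  by move/eqP: T01; rewrite -subr_eq0 => /eqP T01; rewrite -[RHS]T01; ring.
have -> : dforms P q v = h *: dforms P0 q v + k *: forms P0 q.
  by rewrite -Dk addrC subrK.
rewrite Dx crossDr !crossZZ cross_self scaler0 addr0; congr (_ *: _).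
Qed.

(* L = c P(q), where c is the ratio of P x dP to grad F at P(q). This is the  *)
(* pull-back by s of the canonical map of the curve: it does not depend on    *)
(* the local expression P of s, and L is homogeneous of degree 1 in q.        *)
Definition canonical_vec q (L : 'rV[K]_3) := forall d P v, represents s d P ->
  cross q v = grad q -> forall i m,
  forms P q 0 i * cross (forms P q) (dforms P q v) 0 m
  = L 0 i * grad (forms P q) 0 m.

Lemma dforms_shift d P q v c : (forall i, P i \is d.-homog) ->
  dforms P q (v + c *: q) = dforms P q v + (c * d%:R) *: forms P q.
Proof.
move=> hP; apply/rowP=> i.
by rewrite !mxE dderivDr dderivZr (dderiv_euler _ (hP i)) mulrA.
Qed.

(* Chain rule for t \o s = id. *)
Lemma dforms_cross_neq0 d P q v : represents s d P -> oncurve q ->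
  forms P q != 0 -> cross q v = grad q ->
  cross (forms P q) (dforms P q v) != 0.
Proof.
move=> rP Cq x0 qv; apply/eqP=> x0dx.
have [c Dc] := cross_eq0P x0 x0dx.
have Cx := forms_oncurve rP Cq x0.
have [e [Q [rQ y0]]] := (proj2 rt) _ Cx.
set x := forms P q in x0 x0dx Dc Cx y0; set y := forms Q x in y0.
pose R i := mmap (@mpolyC 3 K) P (Q i).
have hR i : R i \is (d * e)%N.-homog by apply: comp_homog => //;
  [exact: rP.1|exact: rQ.1].
have ER p i : (R i).@[p 0] = forms Q (forms P p) 0 i by rewrite eval_comp mxE.
have par p : oncurve p -> forms P p != 0 -> forms Q (forms P p) != 0 ->
    (p == forms Q (forms P p))%MS.
  move=> Cp xp yp; have Cx' := forms_oncurve rP Cp xp.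
  apply: parallel_trans (rQ.2 _ Cx' yp).
  apply: (parallel_trans (parallel_sym (tsK Cp))).
  exact: (regular_par rt ((proj1 rs) p Cp) (rP.2 p Cp xp) Cx'.1).
have [l xl] := row3_neq0 x0.
have T i j : dderiv ('X_i * R j - 'X_j * R i) q v = 0.
  set G := _ - _.
  have Gq : G.@[q 0] = 0.
    rewrite mevalB !mevalM !mevalXU !ER -/x -/y.
    have := par q Cq x0 y0; rewrite -/x -/y => /(parallelP y0)[k _ ->].
    by rewrite !mxE; ring.
  (* The factor [P l] makes the product vanish also at points of the curve where all the forms [P]
     do; it can be cancelled because it is nonzero at [q]. *)
  have : dderiv (G * P l) q v = 0.
    apply: (@tangent_vanish_curve ((1 + d * e) + d)) => // [|p Cp].
      apply: dhomogM; last exact: rP.1.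
      by apply: rpredB; apply: dhomogM => //; rewrite dhomogX /= mdeg1.
    rewrite mevalM mevalB !mevalM !mevalXU !ER.
    have -> : (P l).@[p 0] = forms P p 0 l by rewrite mxE.
    have [->|xp] := eqVneq (forms P p) 0;
      first by rewrite [X in _ * X]mxE mulr0.
    have [->|yp] := eqVneq (forms Q (forms P p)) 0.
      by rewrite !mxE; ring.
    have [k _ Dp] := parallelP yp (par p Cp xp yp).
    have Ep l' : p 0 l' = k * forms Q (forms P p) 0 l' by rewrite {1}Dp mxE.
    by rewrite !Ep; ring.
  rewrite dderivM Gq mul0r addr0 => /eqP; rewrite mulf_eq0 => /orP[/eqP //|].
  have -> : (P l).@[q 0] = x 0 l by rewrite mxE.
  by rewrite (negPf xl).
have [k k0 Dq] := parallelP y0 (par q Cq x0 y0).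
(* If the derivative of [P] is a multiple of [P(q)], Euler's identity for [Q] makes that of [R] a
   multiple of [y], which is parallel to [q]. With [T] this forces [v] to be parallel to [q],
   although [q x v] is the nonzero gradient. *)
have dR i : dderiv (R i) q v = c * e%:R * y 0 i.
  rewrite dderiv_forms_comp -/x Dc dderivZr (dderiv_euler _ (rQ.1 i)) mulrA.
  by rewrite [y 0 i]mxE.
have vy : cross q v = 0.
  have T' i j : v 0 i * y 0 j = v 0 j * y 0 i.
    have := T i j; rewrite dderivB !dderivM !dderivX !mevalXU !ER !dR -/x -/y.
    rewrite Dq [(k *: y) 0 i]mxE [(k *: y) 0 j]mxE => /eqP.
    rewrite subr_eq0 => /eqP E.
    have {E} := congr1 (fun z => z - k * y 0 i * (c * e%:R * y 0 j)) E.
    rewrite addrK => ->; ring.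
  have yv : cross y v = 0.
    have [e0 e1 e2] := crossE y v.
    apply: row3P; rewrite ?e0 ?e1 ?e2 [RHS]mxE.
    - by rewrite mulrC (T' 2 1) mulrC subrr.
    - by rewrite mulrC (T' 0 2) mulrC subrr.
    by rewrite mulrC (T' 1 0) mulrC subrr.
  by rewrite Dq -[v]scale1r crossZZ yv scaler0.
by have := grad_neq0 Cq; rewrite -qv vy eqxx.
Qed.

(** For [P(q) = h P0(q)] the cross product is multiplied by [h^2] and the cubic gradient by [h^3],
    so both sides of the defining relation are multiplied by [h^3]. *)
Lemma canonical_vec_exists q : oncurve q ->
  exists L, [/\ L != 0, (s q == L)%MS & canonical_vec q L].
Proof.
move=> Cq; have [d0 [P0 [r0 x0]]] := (proj2 rs) q Cq.
have [v0 qv0] := tangent_exists Cq.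
have [a Da] := dforms_tangent r0 Cq x0 qv0.
have a0 : a != 0.
  apply: contraNneq (dforms_cross_neq0 r0 Cq x0 qv0) => a0.
  by rewrite Da a0 scale0r.
exists (a *: forms P0 q); split.
- by rewrite scaler_eq0 negb_or a0.
- apply: (parallel_trans (r0.2 q Cq x0));
    exact: (parallel_sym (parallelZ _ a0)).
move=> d P v r qv i m.
have [x|x] := eqVneq (forms P q) 0.
  rewrite x mxE mul0r.
  have g0 : grad (0 *: q) = 0 by rewrite gradZ expr0n scale0r.
  rewrite scale0r in g0; rewrite g0.
  by rewrite [X in _ = _ * X]mxE mulr0.
have [c Dv] := tangent_unique Cq qv0 qv.
have [h h0 Dx] := parallelP x0
  (parallel_trans (parallel_sym (r.2 q Cq x)) (r0.2 q Cq x0)).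
rewrite Dv (dforms_shift _ _ _ r.1) crossDr crossZr cross_self scaler0 addr0.
rewrite (cross_dforms_scale r0 r Cq x0 x qv0 Dx) Da Dx gradZ.
by rewrite !mxE; ring.
Qed.

(** The gradient has degree 3, so a tangent [v] at [q] becomes [c^2 v] at [c q]; the powers of [c]
    then leave a factor [c^(3 d + 1)] against [c^(3 d)]. *)
Lemma canonical_vecZ q c L L' : oncurve q -> c != 0 ->
  canonical_vec q L -> canonical_vec (c *: q) L' -> L' = c *: L.
Proof.
move=> Cq c0 HL HL'; have [d [P [r x0]]] := (proj2 rs) q Cq.
have [v qv] := tangent_exists Cq.
have [m gm] := row3_neq0 (grad_neq0 (forms_oncurve r Cq x0)).
have qv' : cross (c *: q) (c *: (c *: v)) = grad (c *: q).
  by rewrite crossZZ crossZr qv gradZ scalerA -!mulrA; congr (_ *: _).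
have dfE : dforms P (c *: q) (c *: (c *: v)) = c ^+ d.+1 *: dforms P q v.
  apply/rowP=> i; rewrite !mxE (dderivZZ _ _ _ (r.1 i)) dderivZr exprS; ring.
apply/rowP=> i; rewrite mxE; have := HL' d P _ r qv' i m.
rewrite dfE (forms_homog _ _ r.1) crossZZ gradZ.
rewrite [(_ *: forms P q) 0 i]mxE [(_ *: cross _ _) 0 m]mxE
  [(_ *: grad _) 0 m]mxE.
have := HL d P v r qv i m.
move: (forms P q 0 i) (cross _ _ 0 m) (grad _ 0 m) gm => x y g g0 xy E.
apply: (mulIf g0); apply: (mulfI (expf_neq0 (d * 3) c0)).
transitivity (c ^+ d * x * (c ^+ d * c ^+ d.+1 * y)).
  by rewrite E -exprM; ring.
transitivity (c ^+ d * c ^+ d * c ^+ d * c * (x * y)); first by rewrite exprS;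
  ring.
by rewrite xy exprM exprS expr2; ring.
Qed.

Lemma canonical_vec_regular q i : oncurve q ->
  exists N D : {mpoly K[3]}, D.@[q 0] != 0 /\
    forall p L, oncurve p -> canonical_vec p L -> D.@[p 0] * L 0 i = N.@[p 0].
Proof.
move=> Cq; have [d [P [r x0]]] := (proj2 rs) q Cq.
have [m gm] := row3_neq0 (grad_neq0 (forms_oncurve r Cq x0)).
have [n qn] := row3_neq0 Cq.1.
pose u (l : 'I_3) : {mpoly K[3]} :=
  crossf (fun j => F^`M(j)) (fun j => (delta_mx 0 n : 'rV[K]_3) 0 j *: 1) l.
pose du (j : 'I_3) : {mpoly K[3]} := \sum_l u l * (P j)^`M(l).
(* The tangent at [p] is [(grad F(p) x e_n) / p_n]. One power of ['X_n] clears this denominator; the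
   additional one on both sides makes the relation trivial where [p_n = 0]. *)
exists (P i * crossf P du m * 'X_n),
  (mmap (@mpolyC 3 K) P F^`M(m) * 'X_n * 'X_n).
have uE p l : (u l).@[p 0] = cross (grad p) (delta_mx 0 n) 0 l.
  rewrite /u rmorph_crossf mxE.
  elim/ord3P: l; rewrite /crossf /= !mevalZ !meval1 !mxE /=; ring.
have duE p : \row_j (du j).@[p 0] = dforms P p (cross (grad p) (delta_mx 0 n)).
  apply/rowP=> j; rewrite !mxE /du rmorph_sum; apply: eq_bigr => l _ /=.
  by rewrite mevalM uE.
have NE p : (P i * crossf P du m * 'X_n).@[p 0] = forms P p 0 i *
    cross (forms P p) (dforms P p (cross (grad p) (delta_mx 0 n))) 0 m * p 0 n.
  rewrite !mevalM mevalXU rmorph_crossf -duE; congr (_ * _ * _).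
    by rewrite mxE.
  by rewrite mxE /crossf /= !mxE.
have DE p : (mmap (@mpolyC 3 K) P F^`M(m) * 'X_n * 'X_n).@[p 0]
    = grad (forms P p) 0 m * p 0 n * p 0 n.
  by rewrite !mevalM mevalXU eval_comp [grad _ 0 m]mxE.
split; first by rewrite DE !mulf_neq0.
move=> p L Cp HL; rewrite NE DE.
have [->|pn] := eqVneq (p 0 n) 0; first by rewrite !mulr0 mul0r.
pose v := (p 0 n)^-1 *: cross (grad p) (delta_mx 0 n).
have pv : cross p v = grad p.
  by rewrite crossZr (cross_delta _ (dot_grad Cp)) scalerA mulVf // scale1r.
have Dv : cross (grad p) (delta_mx 0 n) = p 0 n *: v.
  by rewrite scalerA mulfV // scale1r.
have dfE : dforms P p (p 0 n *: v) = p 0 n *: dforms P p v.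
  by apply/rowP=> j; rewrite !mxE dderivZr.
rewrite Dv dfE crossZr [(_ *: cross _ _) 0 m]mxE.
by have := HL d P v r pv i m; move: (cross _ _ 0 m) => y E; rewrite mulrCA E;
  ring.
Qed.

Theorem regular_linear : exists2 M : 'M[K]_3, M \in unitmx &
  forall q, oncurve q -> (s q == q *m M)%MS.
Proof.
have [L HL] : exists L : 'rV[K]_3 -> 'rV[K]_3, forall q, oncurve q ->
    [/\ L q != 0, (s q == L q)%MS & canonical_vec q (L q)].
  apply: (functional_choice (fun q l => oncurve q ->
    [/\ l != 0, (s q == l)%MS & canonical_vec q l])) => q.
  have [q0|/eqP q0] := eqVneq q 0; first by exists 0 => -[]; rewrite q0 eqxx.
  have [Fq|/eqP Fq] := eqVneq (F.@[q 0]) 0; last by exists 0 => -[].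
  have [|l Hl] := @canonical_vec_exists q; first by split=> //; apply/eqP.
  by exists l.
have lin i : exists l : 'cV[K]_3, forall q, oncurve q -> L q 0 i = (q *m l) 0 0.
  have [c p c0 p0 Fp|p p0 Fp|l Hl] :=
    @linear_section K F hF smF (fun q => L q 0 i).
  - have Cp : oncurve p by [].
    have [_ _ H1] := HL p Cp; have [_ _ H2] := HL _ (oncurveZ c0 Cp).
    by rewrite (canonical_vecZ Cp c0 H1 H2) mxE.
  - have [N [D [Dp DN]]] := @canonical_vec_regular p i (conj p0 Fp).
    exists N, D; split=> // q q0 Fq; have Cq : oncurve q by [].
    by apply: DN => //; have [] := HL q Cq.
  by exists l => q [q0 Fq]; apply: Hl.
have [l0 H0] := lin 0; have [l1 H1] := lin 1; have [l2 H2] := lin 2.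
pose M : 'M[K]_3 := \matrix_(j, i) (nth 0 [:: l0; l1; l2] i) j 0.
have LM q : oncurve q -> L q = q *m M.
  move=> Cq; apply: row3P; rewrite ?H0 ?H1 ?H2 // !mxE;
  by apply: eq_bigr => j _; rewrite !mxE.
have sM q : oncurve q -> (s q == q *m M)%MS.
  by move=> Cq; rewrite -LM //; have [] := HL q Cq.
(* If [M] were singular, a nonzero linear form would vanish on its image, which contains the whole
   curve since [s \o t] is the identity; this contradicts [small_vanish]. *)
exists M => //; rewrite unitmxE unitfE -det_tr; apply/det0P => -[w w0 wM].
pose G : {mpoly K[3]} := \sum_i w 0 i *: 'X_i.
have GE p : G.@[p 0] = (p *m w^T) 0 0.
  rewrite /G rmorph_sum mxE; apply: eq_bigr => i _.
  by rewrite /= mevalZ mevalXU !mxE mulrC.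
have Mw : M *m w^T = 0 by rewrite -[M]trmxK -trmx_mul wM trmx0.
have hG : G \is 1.-homog.
  by apply: rpred_sum => i _; apply: dhomogZ; rewrite dhomogX /= mdeg1.
have G0 : forall p, G.@[p 0] = 0.
  apply: (small_vanish hF smF hG) => // p p0 Fp; have Cp : oncurve p by [].
  have Ct := (proj1 rt) p Cp.
  have tM0 : t p *m M != 0 by rewrite -LM //; have [] := HL _ Ct.
  have := parallel_trans (parallel_sym (stK Cp)) (sM _ Ct).
  move=> /(parallelP tM0)[c _ ->].
  by rewrite GE -scalemxAl -mulmxA Mw mulmx0 scaler0 mxE.
have [i wi] := row3_neq0 w0; have := G0 (delta_mx 0 i).
rewrite GE -rowE !mxE => wi0; by rewrite wi0 eqxx in wi.
Qed.

End Automorphisms.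

End RegularMaps.

(** * Linear isomorphisms *)

Section LinearMaps.

Variables (k : fieldType) (K : closedFieldType) (iota : {rmorphism k -> K}).
Implicit Types (F G : {mpoly k[3]}) (p q v : 'rV[K]_3) (N : 'M[k]_3).

Local Notation "F ^i" := (map_mpoly iota F) (at level 2, format "F ^i").
Local Notation "N ^m" := (map_mx iota N) (at level 2, format "N ^m").

Lemma map_mpoly_homog d F : F \is d.-homog -> F^i \is d.-homog.
Proof.
move/dhomogP=> hF; apply/dhomogP=> m; rewrite mcoeff_msupp mcoeff_map_mpoly.
rewrite fmorph_eq0 => Fm; apply: hF; by rewrite mcoeff_msupp.
Qed.

Lemma map_mpoly_deriv F i : (F^i)^`M(i) = (F^`M(i))^i.
Proof.
by apply/mpolyP=> m;
  rewrite mcoeff_deriv !mcoeff_map_mpoly mcoeff_deriv raddfMn.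
Qed.

Lemma oncurveP F p : reflect (oncurve F^i p) (on_curve iota F p).
Proof. by apply: (iffP andP) => -[p0 /eqP Fp]. Qed.

Lemma smooth_curveP F : smooth_curve iota F <->
  forall p, p != 0 -> (F^i).@[p 0] = 0 -> exists i, ((F^i)^`M(i)).@[p 0] != 0.
Proof.
split=> sm p.
  move=> p0 /eqP Fp; have [|i] := sm p; first by apply/andP.
  by exists i; rewrite map_mpoly_deriv.
move=> /oncurveP[p0 Fp]; have [i] := sm p p0 Fp.
by exists i; rewrite /form_at -map_mpoly_deriv.
Qed.

Definition linear_forms N (i : 'I_3) : {mpoly k[3]} := \sum_j N j i *: 'X_j.

Lemma linear_forms_homog N i : linear_forms N i \is 1.-homog.
Proof.
by apply: rpred_sum => j _; apply: dhomogZ; rewrite dhomogX /= mdeg1.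
Qed.

Lemma forms_at_linear N p : forms_at iota (linear_forms N) p = p *m N^m.
Proof.
apply/rowP=> i; rewrite !mxE /form_at /linear_forms (raddf_sum (map_mpoly iota))
  raddf_sum.
apply: eq_bigr => j _ /=.
by rewrite map_mpolyZ mevalZ map_mpolyX mevalXU mulrC mxE.
Qed.

Lemma row_mul_neq0 (M : 'M[K]_3) p : M \in unitmx -> p != 0 -> p *m M != 0.
Proof. by move=> uM; apply: contraNneq => pM;
  rewrite -(mulmxK uM p) pM mul0mx. Qed.

Lemma linear_morphism F G N : N \in unitmx ->
    (forall p, on_curve iota F p -> form_at iota G (p *m N^m) = 0) ->
  curve_morphism iota F G (fun p => p *m N^m).
Proof.
move=> uN FG; have uM : N^m \in unitmx by rewrite map_unitmx.
split=> [p Cp|p /andP[p0 _]].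
  have /andP[p0 _] := Cp.
  by rewrite /on_curve FG // eqxx andbT row_mul_neq0.
exists 1%N, (linear_forms N); split; first exact: linear_forms_homog.
  by rewrite forms_at_linear row_mul_neq0.
by move=> q _ _; rewrite forms_at_linear; apply/eqmxP.
Qed.

Lemma linear_isomorphism F G N : N \in unitmx ->
    (forall p, (form_at iota F p == 0) = (form_at iota G (p *m N^m) == 0)) ->
  curve_isomorphism iota F G (fun p => p *m N^m).
Proof.
move=> uN FG; have uM : N^m \in unitmx by rewrite map_unitmx.
split; first by apply: linear_morphism => // p /andP[_]; rewrite FG => /eqP.
exists (fun p => p *m (invmx N)^m); split.
- apply: linear_morphism; first by rewrite unitmx_inv.
  move=> p /andP[_ Gp]; apply/eqP.
  by rewrite FG map_invmx mulmxKV.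
- by move=> p _ /=; rewrite map_invmx mulmxK //; apply/eqmxP.
by move=> p _ /=; rewrite map_invmx mulmxKV //; apply/eqmxP.
Qed.

Lemma dderiv_ext (G H : {mpoly K[3]}) p v :
  (forall q, G.@[q 0] = H.@[q 0]) -> dderiv G p v = dderiv H p v.
Proof.
move=> GH; rewrite -!deriv_line.
suff -> : line p v G = line p v H by [].
apply/eqP; rewrite -subr_eq0; apply/eqP/vanish_poly_eq0 => s.
by rewrite hornerD hornerN !horner_line GH subrr.
Qed.

Lemma dderiv_linear (c : K) (G H : {mpoly K[3]}) (M : 'M[K]_3) p v :
    (forall q, G.@[q 0] = c * H.@[(q *m M) 0]) ->
  dderiv G p v = c * dderiv H (p *m M) (v *m M).
Proof.
move=> GH; rewrite -!deriv_line.
suff -> : line p v G = c%:P * line (p *m M) (v *m M) H.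
  by rewrite derivM derivC mul0r add0r hornerM hornerC.
apply/eqP; rewrite -subr_eq0; apply/eqP/vanish_poly_eq0 => s.
by rewrite hornerD hornerN hornerM hornerC !horner_line GH mulmxDl scalemxAl
  subrr.
Qed.

Lemma quartic_transfer F G N a : N \in unitmx -> a != 0 ->
    smooth_plane_quartic iota F -> G \is 4%N.-homog ->
    (forall p, form_at iota G p = iota a * form_at iota F (p *m N^m)) ->
  smooth_plane_quartic iota G /\ curves_isomorphic iota F G.
Proof.
move=> uN a0 [hF smF] hG GF; have uM : N^m \in unitmx by rewrite map_unitmx.
have ia0 : iota a != 0 by rewrite fmorph_eq0.
split; last first.
  exists (fun p => p *m (invmx N)^m); apply: linear_isomorphism.
    by rewrite unitmx_inv.
  by move=> p; rewrite GF map_invmx mulmxKV // mulf_eq0 (negPf ia0).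
split=> //; apply/smooth_curveP => p p0 Gp.
have [|i] := (smooth_curveP F).1 smF (p *m N^m) (row_mul_neq0 uM p0).
  move/eqP: Gp; rewrite -/(form_at iota G p) GF mulf_eq0 (negPf ia0) /=.
  by move/eqP.
rewrite -dderiv_delta => dF.
have : dderiv G^i p (delta_mx 0 i *m invmx N^m) != 0.
  by rewrite (dderiv_linear _ _ GF) mulmxKV // mulf_neq0.
have [/existsP[j Gj] _|] := boolP [exists j, ((G^i)^`M(j)).@[p 0] != 0];
  first by exists j.
rewrite negb_exists => /forallP Gj.
rewrite /dderiv big1 ?eqxx // => j _; have := Gj j; rewrite negbK => /eqP ->.
by rewrite mulr0.
Qed.

End LinearMaps.

(** * The involution and its field of definition *)

Section GeometricAutomorphisms.

Variable K : closedFieldType.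
Implicit Types (F G : {mpoly K[3]}) (p q v : 'rV[K]_3) (M N : 'M[K]_3).

Local Notation idK := (idfun : {rmorphism K -> K}).

Lemma map_mpoly_idfun F : map_mpoly idK F = F.
Proof. by apply/mpolyP=> m; rewrite mcoeff_map_mpoly. Qed.

Lemma map_mx_idfun M : map_mx idK M = M.
Proof. by apply/matrixP=> i j; rewrite mxE. Qed.

Lemma oncurve_idP F p : reflect (oncurve F p) (on_curve idK F p).
Proof. by have := oncurveP idK F p; rewrite map_mpoly_idfun. Qed.

Lemma regular_morphism F s : curve_morphism idK F F s -> regular F s.
Proof.
have fE P p : forms_at idK P p = forms P p.
  by apply/rowP=> i; rewrite !mxE /form_at map_mpoly_idfun.
case=> sF sP; split=> [p /oncurve_idP/sF/oncurve_idP //|p /oncurve_idP/sP].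
case=> d [P [hP Pp rP]]; exists d, P; rewrite -fE; split=> //.
by split=> // q /oncurve_idP Cq; rewrite -fE; apply: rP.
Qed.

Definition preserves F M := forall p, (F.@[(p *m M) 0] == 0) = (F.@[p 0] == 0).

Lemma preserves_automorphism F M : M \in unitmx -> preserves F M ->
  curve_automorphism idK F (fun p => p *m M).
Proof.
move=> uM FM; have := @linear_isomorphism _ _ idK F F M uM.
by rewrite map_mx_idfun; apply=> p; rewrite /form_at map_mpoly_idfun FM.
Qed.

Section Smooth.

Variable F : {mpoly K[3]}.
Hypothesis hF : F \is 4%N.-homog.
Hypothesis smF : forall p, p != 0 -> F.@[p 0] = 0 ->
  exists i, (F^`M(i)).@[p 0] != 0.

Lemma automorphism_linear s : curve_automorphism idK F s ->
  exists M, [/\ M \in unitmx, forall q, oncurve F q -> (s q == q *m M)%MS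
              & preserves F M].
Proof.
case=> /regular_morphism rs [t [/regular_morphism rt ts st]].
have tsK q : oncurve F q -> (t (s q) == q)%MS by move/oncurve_idP; apply: ts.
have stK q : oncurve F q -> (s (t q) == q)%MS by move/oncurve_idP; apply: st.
have [M uM sM] := regular_linear hF smF rs rt tsK stK.
have F0 : F.@[(0 : 'rV_3) 0] = 0.
  by rewrite -(scale0r (0 : 'rV_3)) (meval_homog _ _ hF) expr0n mul0r.
exists M; split=> // p; have [->|p0] := eqVneq p 0; first by rewrite mul0mx.
apply/eqP/eqP=> Fp; last first.
  have Cp : oncurve F p by [].
  have := oncurve_par hF (row_mul_neq0 uM p0) ((proj1 rs) p Cp).
  by move=> /(_ (parallel_sym (sM p Cp)))[].
have Cr : oncurve F (p *m M) by split=> //; apply: row_mul_neq0.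
have Ct := (proj1 rt) _ Cr.
have := parallel_trans (parallel_sym (stK _ Cr)) (sM _ Ct).
move=> /(parallelP (row_mul_neq0 uM Ct.1))[c c0 Dp].
have -> : p = c *: t (p *m M).
  by apply: (can_inj (mulmxK uM)); rewrite -scalemxAl; exact: Dp.
exact: (oncurveZ hF c0 Ct).2.
Qed.

(** The basis vectors show that [M] is diagonal, and the all-ones vector that its diagonal entries
    agree. *)
Lemma eigen_scalar M : (forall q, exists c, q *m M = c *: q) -> exists c, M =
  c%:M.
Proof.
move=> eig.
have offdiag i j : j != i -> M i j = 0.
  move=> ji; have [c Dc] := eig (delta_mx 0 i).
  have := congr1 (fun u : 'rV_3 => u 0 j) Dc.
  by rewrite -rowE !mxE (negPf ji) andbF mulr0.
have [c Dc] := eig (const_mx 1); exists c; apply/matrixP=> i j.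
rewrite mxE; have [<-|ij] := eqVneq i j; last by rewrite offdiag // eq_sym.
have := congr1 (fun u : 'rV_3 => u 0 i) Dc; rewrite !mxE mulr1 => <-.
rewrite (bigD1 i) //= big1 ?addr0 ?mxE ?mul1r // => l li.
by rewrite offdiag ?mulr0 // eq_sym.
Qed.

(** The coordinates of [qN x qM] are quadratic forms in [q] vanishing on the curve, hence
    identically; so every vector is an eigenvector of [invmx N *m M]. *)
Lemma same_linear_map M N : N \in unitmx ->
  (forall q, oncurve F q -> (q *m M == q *m N)%MS) -> exists c, M = c *: N.
Proof.
move=> uN MN.
pose lM (A : 'M[K]_3) i : {mpoly K[3]} := \sum_j A j i *: 'X_j.
have lE A i q : (lM A i).@[q 0] = (q *m A) 0 i.
  rewrite raddf_sum mxE; apply: eq_bigr => j _ /=.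
  by rewrite mevalZ mevalXU mulrC.
have cE i q : (crossf (lM N) (lM M) i).@[q 0] = cross (q *m N) (q *m M) 0 i.
  by rewrite rmorph_crossf mxE /crossf /= !lE.
have hl A i : lM A i \is 1.-homog.
  by apply: rpred_sum => j _; apply: dhomogZ; rewrite dhomogX /= mdeg1.
have hc i : crossf (lM N) (lM M) i \is 2.-homog.
  by elim/ord3P: i; rewrite /crossf /=; apply: rpredB;
    apply: (@dhomogM _ _ _ 1 _ 1).
have c0 q : cross (q *m N) (q *m M) = 0.
  apply/rowP=> i; rewrite -cE [RHS]mxE;
    apply: (small_vanish hF smF (hc i)) => //.
  move=> {}q q0 Fq; rewrite cE.
  have [c _ ->] := parallelP (row_mul_neq0 uN q0) (MN q (conj q0 Fq)).
  by rewrite crossZr cross_self scaler0 mxE.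
have [|c Dc] := @eigen_scalar (invmx N *m M).
  move=> q; have [->|q0] := eqVneq q 0; first by exists 0;
    rewrite mul0mx scaler0.
  have q'0 : q *m invmx N *m N != 0 by rewrite mulmxKV.
  have [c Dc] := cross_eq0P q'0 (c0 (q *m invmx N)).
  by exists c; rewrite mulmxA Dc mulmxKV.
by exists c; rewrite -[M](mulKVmx uN) Dc mul_mx_scalar.
Qed.

Lemma Z2_cases : exists h : 'Z_2, [/\ h <> 1%g, (h * h = 1)%g &
  forall g : 'Z_2, g = 1%g \/ g = h].
Proof.
exists (inZp 1); split; [by [] | exact: val_inj |].
by case=> [[|[|//]] lt]; [left | right]; apply: val_inj.
Qed.

(* From M ^ 2 = c, a square root of c is not needed to normalise M: since     *)
(* (det M) ^ 2 = c ^ 3, the matrix (c / det M) M has square 1.                *)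
Lemma geometric_involution : aut_group_isog idK F 'Z_2 ->
  exists M, [/\ M *m M = 1%:M, forall c, M <> c%:M, preserves F M
    & forall A, A \in unitmx -> preserves F A ->
        exists c, A = c%:M \/ A = c *: M].
Proof.
case=> rho [rA rM rI rS]; have [h [h1 hh hP]] := Z2_cases.
have C_rho g p : oncurve F p -> oncurve F (rho g p).
  by move=> Cp; have [/regular_morphism[rg _] _] := rA g; apply: rg.
have pid : preserves F 1%:M by move=> p; rewrite mulmx1.
(* That [rho 1] is the identity follows: the element [g] inducing the identity satisfies [g * g = g]
   by injectivity of [rho]. *)
have [g idg] := rS _ (preserves_automorphism (unitmx1 _ _) pid).
have {}idg p : oncurve F p -> (rho g p == p)%MS.
  by move/oncurve_idP => /idg; rewrite mulmx1; apply: parallel_sym.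
have g1 : g = 1%g.
  apply: (mulgI g); rewrite mulg1; apply: rI => p /oncurve_idP Cp.
  apply: (parallel_trans (rM g g p (introT (oncurve_idP F p) Cp))).
  exact: idg (C_rho _ _ Cp).
rewrite g1 in idg.
have [M [uM sM FM]] := automorphism_linear (rA h).
have nscal c : M <> c%:M.
  move=> Mc; apply: h1; apply: rI => p /oncurve_idP Cp.
  apply: (parallel_trans (sM p Cp)); apply: parallel_sym.
  apply: (parallel_trans (idg p Cp)); apply: parallel_sym.
  rewrite Mc mul_mx_scalar; apply: parallelZ.
  apply: contraTneq uM => c0; rewrite Mc c0.
  by rewrite unitmxE det_scalar expr0n unitr0.
have [c MM] : exists c, M *m M = c *: 1%:M.
  apply: same_linear_map; first exact: unitmx1.
  move=> q Cq; have Cs := C_rho h q Cq.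
  rewrite mulmx1; apply: parallel_sym.
  apply: (parallel_trans (parallel_sym (idg q Cq))); rewrite -hh.
  apply: (parallel_trans (rM h h q (introT (oncurve_idP F q) Cq))).
  apply: (parallel_trans (sM _ Cs)).
  have [a a0 ->] := parallelP (row_mul_neq0 uM Cq.1) (sM q Cq).
  by rewrite mulmxA -scalemxAl; apply: parallelZ.
have detM : \det M != 0 by rewrite -unitfE -unitmxE.
have dc : \det M ^+ 2 = c ^+ 3.
  by rewrite expr2 -det_mulmx MM detZ det1 mulr1.
have c0 : c != 0.
  by apply: contraNneq detM => c0; move/eqP: dc; rewrite c0 expr0n expf_eq0.
pose a := c / \det M.
have a0 : a != 0 by rewrite mulf_neq0 ?invr_neq0.
have FZ b p : b != 0 -> (F.@[(b *: p) 0] == 0) = (F.@[p 0] == 0).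
  by move=> b0; rewrite (meval_homog _ _ hF) mulf_eq0 expf_eq0 (negPf b0).
exists (a *: M); split.
- rewrite -scalemxAl -scalemxAr MM !scalerA -expr2 expr_div_n -mulrA
    (mulrC _ c).
  by rewrite mulrA dc -exprSr mulfV ?expf_neq0 // scale1r.
- move=> b Mb; apply: (nscal (a^-1 * b)); rewrite -scale_scalar_mx -Mb.
  by rewrite scalerA mulVf // scale1r.
- by move=> p; rewrite -scalemxAr FZ.
move=> A uA FA; have [x xA] := rS _ (preserves_automorphism uA FA).
have {}xA q : oncurve F q -> (q *m A == rho x q)%MS by move/oncurve_idP/xA.
case: (hP x) => Dx; rewrite Dx in xA.
  have [|b Db] := @same_linear_map A 1%:M (unitmx1 _ _).
    by move=> q Cq; rewrite mulmx1; apply: parallel_trans (xA q Cq) (idg q Cq).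
  by exists b; left; rewrite Db scale_scalar_mx mulr1.
have [|b Db] := @same_linear_map A M uM.
  by move=> q Cq; apply: parallel_trans (xA q Cq) (sM q Cq).
by exists (b / a); right; rewrite scalerA mulfVK.
Qed.

End Smooth.

End GeometricAutomorphisms.

(** * Frobenius and the descent of the involution to [k] *)

Section Frobenius.

Variables (k : finFieldType) (K : closedFieldType) (iota : {rmorphism k -> K}).

(* iota is a parameter because additivity depends on it. *)
Definition frobenius of {rmorphism k -> K} := fun u : K => u ^+ #|k|.

Local Notation frob := (frobenius iota).

Lemma pchar_pow_card : [pchar K].-nat #|k|.
Proof.
have [p p_pr kp] := finPcharP k.
have Kp : p \in [pchar K] by rewrite (fmorph_pchar iota).
rewrite (eq_pnat _ (pcharf_eq Kp)) -cardsT.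
exact: abelem_pgroup (fin_ring_pchar_abelem kp).
Qed.

Fact frobenius_zmod_morphism : zmod_morphism frob.
Proof.
move=> u v; apply/eqP; rewrite eq_sym subr_eq /frobenius.
by rewrite -exprDn_pchar ?subrK // pchar_pow_card.
Qed.

Fact frobenius_monoid_morphism : monoid_morphism frob.
Proof. by split=> [|u v]; rewrite /frobenius ?expr1n ?exprMn. Qed.

HB.instance Definition _ :=
  GRing.isZmodMorphism.Build K K frob frobenius_zmod_morphism.
HB.instance Definition _ :=
  GRing.isMonoidMorphism.Build K K frob frobenius_monoid_morphism.

Lemma frobenius_iota x : frob (iota x) = iota x.
Proof. by rewrite /frobenius -rmorphXn expf_card. Qed.

Lemma frobenius_surj u : exists v, frob v = u.
Proof.
have q0 : (0 < #|k|)%N by apply/card_gt0P; exists 0.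
have [v Dv] := solve_monicpoly (fun i => if i == 0%N then u else 0) q0.
exists v; rewrite /frobenius Dv; case: #|k| q0 => // n _.
rewrite big_ord_recl /= expr0 mulr1 big1 ?addr0 // => i _.
by rewrite mul0r.
Qed.

(** A fixed point is a root of [X^|k| - X], which is the product of the [X - x] for [x] in [k]. *)
Lemma frobenius_fixed u : frob u = u -> exists x, u = iota x.
Proof.
move=> fu; have := congr1 (fun p => (map_poly iota p).[u]) (finField_genPoly k).
rewrite rmorphB /= map_polyXn map_polyX !hornerE -[u ^+ _]/(frob u) fu subrr.
rewrite rmorph_prod horner_prod => /esym/eqP; rewrite prodf_seq_eq0.
case/hasP=> x _ /=; rewrite map_polyXsubC hornerXsubC subr_eq0 => /eqP ->.
by exists x.
Qed.

Lemma frobenius_eval (C : {mpoly k[3]}) (p : 'rV[K]_3) :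
  (map_mpoly iota C).@[map_mx frob p 0] = frob (map_mpoly iota C).@[p 0].
Proof.
have E q : (map_mpoly iota C).@[q 0] = mmap iota (q 0) C.
  rewrite /map_mpoly rmorph_mmap; apply: eq_mmap => [c|i] /=;
    first exact: mevalC.
  exact: mevalXU.
rewrite !E rmorph_mmap; apply: eq_mmap => [c|i] /=;
  first by rewrite frobenius_iota.
by rewrite mxE.
Qed.

Lemma map_frobenius_surj n (p : 'rV[K]_n) : exists q, p = map_mx frob q.
Proof.
have [f Df] := fin_all_exists (fun i => frobenius_surj (p 0 i)).
by exists (\row_i f i); apply/rowP=> i; rewrite !mxE.
Qed.

(** As [C] has coefficients in [k], evaluation commutes with Frobenius, which is bijective on
    vectors over [K]. *)
Lemma frobenius_preserves (C : {mpoly k[3]}) (M : 'M[K]_3) :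
  preserves (map_mpoly iota C) M ->
    preserves (map_mpoly iota C) (map_mx frob M).
Proof.
move=> CM p; have [q ->] := map_frobenius_surj p.
by rewrite -map_mxM !frobenius_eval !fmorph_eq0 CM.
Qed.

(* The Frobenius conjugate of M is c M with c ^ 2 = c ^ 3 = 1.                *)
Lemma involution_descent (C : {mpoly k[3]}) : smooth_plane_quartic iota C ->
    geom_aut_group_isog iota C 'Z_2 ->
  exists N : 'M[k]_3, let M := map_mx iota N in
    [/\ N *m N = 1%:M, forall c, N <> c%:M, preserves (map_mpoly iota C) M
      & forall A, A \in unitmx -> preserves (map_mpoly iota C) A ->
          exists c, A = c%:M \/ A = c *: M].
Proof.
case=> hC /smooth_curveP smC autC; have hF := map_mpoly_homog iota hC.
have [M [MM nM FM FA]] := geometric_involution hF smC autC.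
have uM : M \in unitmx by case/mulmx1_unit: MM.
have uM' : map_mx frob M \in unitmx by rewrite map_unitmx.
have [c [Dc|Dc]] := FA _ uM' (frobenius_preserves FM).
  (* A scalar conjugate would make [M] itself scalar, by injectivity of Frobenius. *)
  have inj : injective frob by apply: fmorph_inj.
  case: (nM (M 0 0)); apply/matrixP=> i j.
  have E i' j' : frob (M i' j') = c *+ (i' == j').
    by have := congr1 (fun A : 'M[K]_3 => A i' j') Dc; rewrite !mxE.
  rewrite mxE; have [ij|ij] := eqVneq i j; apply: inj.
    by rewrite !E ij !eqxx.
  by rewrite E (negPf ij) rmorph0.
have c1 : c = 1.
  have detM2 : \det M ^+ 2 = 1 by rewrite expr2 -det_mulmx MM det1.
  have det0 : \det M != 0 by rewrite -unitfE -unitmxE.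
  have fdet : frob (\det M) = \det M.
    move/eqP: detM2; rewrite sqrf_eq1 => /orP[] /eqP ->.
      by rewrite rmorph1.
    by rewrite rmorphN1.
  have c3 : c ^+ 3 = 1.
    by apply: (mulIf det0); rewrite mul1r -detZ -Dc det_map_mx.
  have c2 : c ^+ 2 = 1.
    have : map_mx frob M *m map_mx frob M = 1%:M by rewrite -map_mxM MM map_mx1.
    rewrite Dc -scalemxAl -scalemxAr MM scalerA => /matrixP/(_ 0 0).
    by rewrite !mxE mulr1.
  by move: c3; rewrite exprS c2 mulr1.
rewrite c1 scale1r in Dc.
have entry i j : exists x, M i j = iota x.
  apply: frobenius_fixed.
  by have := congr1 (fun A : 'M[K]_3 => A i j) Dc; rewrite mxE.
have [f Df] := fin_all_exists (fun i => fin_all_exists (entry i)).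
pose N : 'M[k]_3 := \matrix_(i, j) f i j.
have DM : M = map_mx iota N by apply/matrixP=> i j; rewrite !mxE.
exists N; rewrite -DM; split=> //.
  by apply: (map_mx_inj (f := iota)); rewrite map_mxM -DM MM map_mx1.
by move=> c' Nc; apply: (nM (iota c')); rewrite DM Nc map_scalar_mx.
Qed.

End Frobenius.

(** * Reduction to an even quartic *)

Section EvenForm.

Variable k : fieldType.

Lemma prod3 (R : comNzRingType) (f : 'I_3 -> R) : \prod_i f i = f 0 * f 1 * f 2.
Proof.
rewrite !big_ord_recr big_ord0 /= mul1r.
by congr (f _ * f _ * f _); apply: val_inj.
Qed.

Lemma homog_quartic_coefs (G : {mpoly k[3]}) : G \is 4%N.-homog ->
  exists c : nat -> nat -> k, G = \sum_(i < 5) \sum_(j < 5 - i)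
    c i j *: ('X_(0 : 'I_3) ^+ i * 'X_(1 : 'I_3) ^+ j * 'X_(2 : 'I_3) ^+ (4 - i
      - j)).
Proof.
move/dhomogP=> hG; rewrite [G]mpolyE.
pose P (H : {mpoly k[3]}) := exists c : nat -> nat -> k, H =
  \sum_(i < 5) \sum_(j < 5 - i)
    c i j *: ('X_(0 : 'I_3) ^+ i * 'X_(1 : 'I_3) ^+ j * 'X_(2 : 'I_3) ^+ (4 - i
      - j)).
rewrite big_seq; apply: (big_ind P).
- exists (fun _ _ => 0); rewrite big1 // => i _; rewrite big1 // => j _.
  by rewrite scale0r.
- move=> _ _ [c ->] [c' ->]; exists (fun i j => c i j + c' i j).
  rewrite -big_split /=; apply: eq_bigr => i _; rewrite -big_split /=.
  by apply: eq_bigr => j _; rewrite scalerDl.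
move=> m /hG /=; rewrite mdegE sum3.
pose a : nat := m 0; pose b : nat := m 1; rewrite -/a -/b => dm.
exists (fun i j => G@_m *+ ((i == a) && (j == b))).
have lt_a5 : (a < 5)%N by lia.
have lt_b : (b < 5 - a)%N by lia.
rewrite (bigD1 (Ordinal lt_a5)) //= (bigD1 (Ordinal lt_b)) //= !eqxx mulr1n.
rewrite big1 ?addr0 => [|j]; last first.
  by rewrite -val_eqE /= => /negPf ->; rewrite mulr0n scale0r.
rewrite big1 ?addr0 => [|i]; last first.
  rewrite -val_eqE /= => /negPf ni; rewrite big1 // => j _.
  by rewrite ni mulr0n scale0r.
congr (_ *: _); rewrite mpolyXE_id prod3; congr (_ * _ * _ ^+ _); lia.
Qed.

Hypothesis two_neq0 : (2%:R : k) != 0.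

(** [N] is killed by [(X - 1)(X + 1)], with distinct roots as 2 is invertible, so it is
    diagonalisable with entries 1 or -1. Up to the global sign [(-1) ^+ s] it becomes
    [diag(-1, 1, 1)]. *)
Lemma involution_diag (N : 'M[k]_3) : N *m N = 1%:M -> (forall c, N <> c%:M) ->
  exists E (s : bool), E \in unitmx /\
    forall i, row i E *m N = (-1) ^+ (s (+) (i == 0)) *: row i E.
Proof.
move=> NN nN.
have [P uP] : diagonalizable N.
  apply/diagonalizableP; exists [:: 1; -1].
    rewrite /= inE andbT; apply: contraNneq two_neq0 => /eqP.
    by rewrite -subr_eq0 opprK -natr1.
  apply: mxminpoly_min; rewrite !big_cons big_nil mulr1 rmorphM !rmorphB /=.
  rewrite !horner_mx_X !horner_mx_C -mulmxE rmorphN rmorph1 opprK.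
  by rewrite mulmxBl mul1mx mulmxDr NN mulmx1 (addrC 1%:M) subrr.
case/diagonalizable_forPex=> d /(simmxP uP) PN.
have dPN i : row i P *m N = d 0 i *: row i P.
  by apply/rowP=> j; rewrite -row_mul PN mul_diag_mx !mxE.
have P0 i : row i P != 0.
  apply: contraTneq uP => P0; rewrite -row_free_unit.
  apply/negP => /row_freeP[B PB]; have := congr1 (row i) PB.
  rewrite row_mul P0 mul0mx => /rowP/(_ i); rewrite !mxE eqxx => /esym/eqP.
  by rewrite oner_eq0.
have /fin_all_exists[s Ds] i : exists b : bool, d 0 i = (-1) ^+ b.
  have : d 0 i ^+ 2 *: row i P = row i P.
    by rewrite expr2 -scalerA -dPN scalemxAl -dPN -mulmxA NN mulmx1.
  move/eqP; rewrite -subr_eq0 -[X in _ - X]scale1r -scalerBl scaler_eq0.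
  rewrite (negPf (P0 i)) orbF subr_eq0 sqrf_eq1 => /orP[]/eqP ->.
    by exists false.
  by exists true; rewrite expr1.
(* Of three signs that are not all equal, exactly one differs from the other two; its eigenvector is
   moved to the first row. *)
have [j Dj] : exists j, forall i, i != j -> s i = ~~ s j.
{ have all_eq : s 0 = s 1 -> s 0 = s 2 -> False.
    move=> s01 s02; apply: (nN (d 0 0)).
    have dE : d = const_mx (d 0 0).
      by apply/rowP=> l; elim/ord3P: l; rewrite mxE ?Ds -?s01 -?s02.
    by rewrite -(mulKmx uP N) PN dE diag_const_mx -scalar_mxC mulKmx // mxE.
  case e0: (s 0) all_eq; case e1: (s 1); case e2: (s 2) => all_eq;
  first [ by exists 0; elim/ord3P => //; rewrite ?e0 ?e1 ?e2
        | by exists 1; elim/ord3P => //; rewrite ?e0 ?e1 ?e2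
        | by exists 2; elim/ord3P => //; rewrite ?e0 ?e1 ?e2
        | by case: all_eq ]. }
exists (xrow 0 j P), (~~ s j); split.
  by rewrite /xrow row_permE unitmx_mul unitmx_perm.
move=> i; have -> : row i (xrow 0 j P) = row (tperm 0 j i) P.
  by apply/rowP=> l; rewrite !mxE.
rewrite dPN Ds; congr ((-1) ^+ nat_of_bool _ *: _).
case: tpermP => [->|->|/eqP i0 /eqP ij].
- by rewrite eqxx addbT negbK.
- rewrite addbC; case: eqVneq => [<-|j0]; first by rewrite addbC addbT negbK.
  by rewrite Dj // eq_sym.
by rewrite (negPf i0) addbF Dj.
Qed.

End EvenForm.

Definition vec3 (R : nzRingType) (x y z : R) : 'rV[R]_3 :=
  \row_i nth 0 [:: x; y; z] i.

Lemma vec3E (R : nzRingType) (p : 'rV[R]_3) : p = vec3 (p 0 0) (p 0 1) (p 0 2).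
Proof. by apply/rowP; elim/ord3P; rewrite mxE. Qed.

Definition even_quartic (R : nzRingType) (a q0 q1 q2 r0 r1 r2 r3 r4 x y z : R) :
  R :=
  a * x ^+ 4 + x ^+ 2 * (q0 * y ^+ 2 + q1 * y * z + q2 * z ^+ 2)
  + r0 * y ^+ 4 + r1 * y ^+ 3 * z + r2 * y ^+ 2 * z ^+ 2 + r3 * y * z ^+ 3
  + r4 * z ^+ 4.

Lemma rmorph_even_quartic (R S : comNzRingType) (f : {rmorphism R -> S})
    a q0 q1 q2 r0 r1 r2 r3 r4 x y z :
  f (even_quartic a q0 q1 q2 r0 r1 r2 r3 r4 x y z) =
  even_quartic (f a) (f q0) (f q1) (f q2) (f r0) (f r1) (f r2) (f r3) (f r4)
    (f x) (f y) (f z).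
Proof. by rewrite /even_quartic !(rmorphD, rmorphM). Qed.

Lemma mevalXn n (R : comNzRingType) (v : 'I_n -> R) (G : {mpoly R[n]}) m :
  (G ^+ m).@[v] = G.@[v] ^+ m.
Proof. exact: rmorphXn. Qed.

Definition meval_simp := (mevalD, mevalM, mevalXn, mevalZ, mevalXU).

(** * Quartics invariant under [x |-> - x] *)

Section FlipInvariant.

Variables (K : closedFieldType) (F : {mpoly K[3]}) (c : nat -> nat -> K).
Hypothesis two_neq0 : (2%:R : K) != 0.
Hypothesis hF : F \is 4%N.-homog.
Hypothesis smF : forall p : 'rV[K]_3, p != 0 -> F.@[p 0] = 0 ->
  exists i, (F^`M(i)).@[p 0] != 0.
Hypothesis Fc : forall x y z, F.@[vec3 x y z 0] =
  \sum_(i < 5) \sum_(j < 5 - i) c i j * (x ^+ i * y ^+ j * z ^+ (4 - i - j)).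
Hypothesis flipF : forall x y z,
  F.@[vec3 x y z 0] = 0 -> F.@[vec3 (- x) y z 0] = 0.

Let even x y z : K := even_quartic (c 4 0) (c 2 2) (c 2 1) (c 2 0)
  (c 0 4) (c 0 3) (c 0 2) (c 0 1) (c 0 0) x y z.

Let odd x y z : K := x ^+ 3 * (c 3 1 * y + c 3 0 * z)
  + x * (c 1 3 * y ^+ 3 + c 1 2 * y ^+ 2 * z + c 1 1 * y * z ^+ 2
         + c 1 0 * z ^+ 3).

Lemma even_odd x y z : F.@[vec3 x y z 0] = even x y z + odd x y z.
Proof.
rewrite Fc !(big_ord_recr, big_ord0) /= /even /odd /even_quartic.
by rewrite !expr0; ring.
Qed.

(** The flipped quartic vanishes on the curve, so it is a multiple of [F]; flipping twice shows that
    the square of the factor is 1. *)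
Lemma flip_sign : exists2 s, s ^+ 2 = 1 &
  forall x y z, F.@[vec3 (- x) y z 0] = s * F.@[vec3 x y z 0].
Proof.
pose P (i : 'I_3) : {mpoly K[3]} := (if i == 0 then -1 else 1) *: 'X_i.
have hP i : P i \is 1.-homog by apply: dhomogZ; rewrite dhomogX /= mdeg1.
have PE x y z : forms P (vec3 x y z) = vec3 (- x) y z.
  by apply/rowP; elim/ord3P; rewrite !mxE mevalZ mevalXU mxE /= ?mulN1r ?mul1r.
have [|s Ds] := quartic_vanish hF smF (comp_homog hP hF).
  by move=> p _ Fp; rewrite eval_comp (vec3E p) PE flipF // -vec3E.
have {}Ds x y z : F.@[vec3 (- x) y z 0] = s * F.@[vec3 x y z 0].
  by rewrite -Ds eval_comp PE.
exists s => //; have [p Fp] := nonvanishing_point smF; rewrite (vec3E p) in Fp.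
by apply: (mulIf Fp); rewrite mul1r expr2 -mulrA -!Ds opprK.
Qed.

(* If F were odd in x, it would be divisible by x, and singular at a common   *)
(* zero of x and of the cofactor.                                             *)
Lemma flip_even : (forall x y z, F.@[vec3 x y z 0] = even x y z) /\ c 4 0 != 0.
Proof.
have [s s2 Fs] := flip_sign.
have evenN x y z : even (- x) y z = even x y z by rewrite /even /even_quartic;
  ring.
have oddN x y z : odd (- x) y z = - odd x y z by rewrite /odd; ring.
have half (u : K) : u + u = 0 -> u = 0.
  by rewrite -mulr2n -mulr_natl => /eqP;
    rewrite mulf_eq0 (negPf two_neq0) => /eqP.
have s1 : s = 1.
  move/eqP: s2; rewrite sqrf_eq1 => /orP[/eqP // | /eqP sN].
  have F0 x y z : F.@[vec3 x y z 0] = odd x y z.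
    suff e0 : even x y z = 0 by rewrite even_odd e0 add0r.
    apply: half; have := Fs x y z; rewrite !even_odd evenN oddN sN => E.
    have := congr1 (fun t => t + (even x y z + odd x y z)) E.
    by rewrite mulN1r addNr => <-; ring.
  pose cub : {poly K} := \poly_(j < 4) c 1 j.
  have [y [z [yz cyz]]] : exists y z, vec3 0 y z != 0 /\
      c 1 3 * y ^+ 3 + c 1 2 * y ^+ 2 * z + c 1 1 * y * z ^+ 2
      + c 1 0 * z ^+ 3 = 0.
    have [c3|c3] := eqVneq (c 1%N 3) 0.
      exists 1, 0; rewrite c3; split; last by ring.
      by apply/eqP=> /rowP/(_ 1)/eqP; rewrite !mxE oner_eq0.
    have /closed_rootP[y] : size cub != 1%N by rewrite size_poly_eq.
    rewrite rootE horner_poly !big_ord_recr big_ord0 /= => /eqP cy.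
    exists y, 1; split; last by rewrite -cy; ring.
    by apply/eqP=> /rowP/(_ 2)/eqP; rewrite !mxE oner_eq0.
  have [|i] := smF yz; first by rewrite F0 /odd cyz; ring.
  pose H : {mpoly K[3]} := 'X_0 ^+ 2 * (c 3 1 *: 'X_1 + c 3 0 *: 'X_2)
    + (c 1 3 *: 'X_1 ^+ 3 + c 1 2 *: ('X_1 ^+ 2 * 'X_2)
       + c 1 1 *: ('X_1 * 'X_2 ^+ 2) + c 1 0 *: 'X_2 ^+ 3).
  rewrite -dderiv_delta (@dderiv_ext _ _ ('X_0 * H)) => [|q].
    have Hp : H.@[vec3 0 y z 0] = 0.
      rewrite /H !meval_simp !mxE /=.
      by rewrite -[RHS]cyz; ring.
    by rewrite dderivM dderivX mevalXU Hp mulr0 add0r mxE mul0r eqxx.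
  rewrite (vec3E q) F0 /H /odd.
  rewrite !meval_simp !mxE /=.
  by ring.
have Fev x y z : F.@[vec3 x y z 0] = even x y z.
  suff o0 : odd x y z = 0 by rewrite even_odd o0 addr0.
  apply: half; have := Fs x y z; rewrite !even_odd evenN oddN s1 mul1r => E.
  have := congr1 (fun t => t - (even x y z - odd x y z)) E.
  by rewrite subrr => E'; rewrite [RHS]E'; ring.
(* Without the term in [x^4], [F] lies in the square of the ideal [(y, z)] and is singular at
   [(1 : 0 : 0)]. *)
split=> //; apply/eqP=> c40.
pose p : 'rV[K]_3 := vec3 1 0 0.
have p0 : p != 0.
  by apply/eqP=> /rowP/(_ 0)/eqP; rewrite !mxE oner_eq0.
have [|i] := smF p0.
  by rewrite Fev /even /even_quartic c40; ring.
pose U : {mpoly K[3]} := 'X_0 ^+ 2 * (c 2 2 *: 'X_1 + c 2 1 *: 'X_2)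
  + (c 0 4 *: 'X_1 ^+ 3 + c 0 3 *: ('X_1 ^+ 2 * 'X_2)
     + c 0 2 *: ('X_1 * 'X_2 ^+ 2) + c 0 1 *: 'X_2 ^+ 3).
pose V : {mpoly K[3]} := 'X_0 ^+ 2 * (c 2 0 *: 'X_2) + c 0 0 *: 'X_2 ^+ 3.
rewrite -dderiv_delta (@dderiv_ext _ _ ('X_1 * U + 'X_2 * V)) => [|q].
  rewrite dderivD !dderivM !dderivX !mevalXU /U /V.
  rewrite !meval_simp !mxE /=.
  by rewrite !(mulr0, mul0r, addr0) eqxx.
rewrite (vec3E q) Fev /even /even_quartic c40 /U /V.
rewrite !meval_simp !mxE /=.
by ring.
Qed.

End FlipInvariant.

Section FormAt.

Variables (k : fieldType) (K : closedFieldType) (iota : {rmorphism k -> K}).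
Implicit Types (F G : {mpoly k[3]}) (p : 'rV[K]_3).

Lemma form_at_mmap F p : form_at iota F p = mmap iota (p 0) F.
Proof.
rewrite /form_at /map_mpoly rmorph_mmap; apply: eq_mmap => [c|i] /=.
  exact: mevalC.
exact: mevalXU.
Qed.

Lemma form_atX i p : form_at iota 'X_i p = p 0 i.
Proof. by rewrite form_at_mmap mmapX mmap1U. Qed.

Lemma form_atM F G p : form_at iota (F * G) p =
  form_at iota F p * form_at iota G p.
Proof. by rewrite !form_at_mmap rmorphM. Qed.

Lemma form_atXn F m p : form_at iota (F ^+ m) p = form_at iota F p ^+ m.
Proof. by rewrite !form_at_mmap rmorphXn. Qed.

Lemma form_atZ c F p : form_at iota (c *: F) p = iota c * form_at iota F p.
Proof. by rewrite !form_at_mmap mmapZ. Qed.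

Lemma form_at_sum I (r : seq I) (P : pred I) (F : I -> {mpoly k[3]}) p :
  form_at iota (\sum_(i <- r | P i) F i) p =
    \sum_(i <- r | P i) form_at iota (F i) p.
Proof.
by rewrite form_at_mmap raddf_sum; apply: eq_bigr => i _; rewrite form_at_mmap.
Qed.

Definition form_at_simp := (form_atM, form_atXn, form_atZ, form_atX).

Lemma form_at_linear F (N : 'M[k]_3) p :
  form_at iota (mmap (@mpolyC 3 k) (linear_forms N) F) p =
  form_at iota F (p *m map_mx iota N).
Proof.
rewrite -forms_at_linear !form_at_mmap (rmorph_mmap (@mpolyC 3 k)).
apply: eq_mmap => [c|i] /=; first by rewrite mmapC.
by rewrite mxE form_at_mmap.
Qed.

End FormAt.

(** * From the involution over [k] to the shape [a x^4 + x^2 q(y, z) + r(y, z)] *)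

Section Reduction.

Variables (k : finFieldType) (K : closedFieldType) (iota : {rmorphism k -> K}).
Hypothesis two_neq0 : (2%:R : k) != 0.

Lemma even_reduction (C : {mpoly k[3]}) : smooth_plane_quartic iota C ->
    geom_aut_group_isog iota C 'Z_2 ->
  exists (E : 'M[k]_3) a q0 q1 q2 r0 r1 r2 r3 r4,
    [/\ E \in unitmx, a != 0, ~~ [&& q0 == 0, q1 == 0 & q2 == 0]
      & forall x y z, form_at iota C (vec3 x y z *m map_mx iota E) =
          even_quartic (iota a) (iota q0) (iota q1) (iota q2)
            (iota r0) (iota r1) (iota r2) (iota r3) (iota r4) x y z].
Proof.
move=> smC autC; have [hC _] := smC.
have [N [NN nN CN CA]] := involution_descent smC autC.
have [E [s [uE EN]]] := involution_diag two_neq0 NN nN.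
set M := map_mx iota N in CN CA.
pose E' := map_mx iota E; have uE' : E' \in unitmx by rewrite map_unitmx.
have two_K : (2%:R : K) != 0.
  by rewrite -(rmorph_nat iota) fmorph_eq0.
have E'M i : row i E' *m M = (-1) ^+ (s (+) (i == 0)) *: row i E'.
  rewrite -!map_row -map_mxM EN map_mxZ; congr (_ *: _).
  by rewrite rmorphXn rmorphN1.
pose G := mmap (@mpolyC 3 k) (linear_forms E) C.
have hG : G \is 4%N.-homog by exact: (comp_homog (linear_forms_homog E) hC).
have GE p : form_at iota G p = form_at iota C (p *m E') by
  exact: form_at_linear.
have [[_ /smooth_curveP smG] _] :
  smooth_plane_quartic iota G /\ curves_isomorphic iota C G.
  apply: (quartic_transfer uE (oner_neq0 k) smC hG) => p.
  by rewrite rmorph1 mul1r GE.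
have [c Dc] := homog_quartic_coefs hG.
have [||ev c40] := @flip_even K (map_mpoly iota G) (fun i j => iota (c i j))
  two_K
    (map_mpoly_homog iota hG) smG.
- move=> x y z; rewrite -/(form_at iota G _) Dc form_at_sum;
    apply: eq_bigr => i _.
  rewrite form_at_sum; apply: eq_bigr => j _.
  by rewrite !form_at_simp !mxE.
- move=> x y z; rewrite -!/(form_at iota G _) !GE => Cp.
  have fl : vec3 x y z *m E' *m M = (-1) ^+ s *: (vec3 (- x) y z *m E').
    rewrite (mulmx_sum_row _ E') (mulmx_sum_row (vec3 (- x) y z)) !sum3 !mulmxDl
      -!scalemxAl !E'M !mxE /= addbT !addbF.
    rewrite signrN !scalerDr !scalerA.
    by move: ((-1) ^+ s) => t; apply/rowP=> l; rewrite !mxE; ring.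
  have sgn0 : (-1) ^+ s != 0 :> K by rewrite signr_eq0.
  have := CN (vec3 x y z *m E');
    rewrite fl (meval_homog _ _ (map_mpoly_homog iota hC)).
  rewrite mulf_eq0 expf_eq0 (negPf sgn0) /=.
  by rewrite /form_at in Cp *; rewrite Cp eqxx => /eqP.
exists E, (c 4 0), (c 2 2), (c 2 1), (c 2 0), (c 0 4), (c 0 3), (c 0 2),
  (c 0 1), (c 0 0).
have Cev x y z : form_at iota C (vec3 x y z *m E') = even_quartic (iota (c 4 0))
    (iota (c 2 2)) (iota (c 2 1)) (iota (c 2 0)) (iota (c 0 4)) (iota (c 0 3))
    (iota (c 0 2)) (iota (c 0 1)) (iota (c 0 0)) x y z.
  by rewrite -GE; apply: ev.
split=> //; first by rewrite fmorph_eq0 in c40.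
(* If [q = 0], then [x |-> j x] with [j^2 = -1] preserves the curve. In the basis [E'] it is
   [diag(j, 1, 1)], which must be a multiple of the identity or of [diag(-1, 1, 1)]; either way
   [j^2 = 1], which is impossible as 2 is nonzero. *)
apply/negP => /and3P[/eqP q0 /eqP q1 /eqP q2].
have [j j2] : exists j : K, j ^+ 2 = -1.
  have [j Dj] := @solve_monicpoly K 2 (fun i => if i == 0%N then -1 else 0) isT.
  by exists j; rewrite Dj !big_ord_recr big_ord0 /= mul0r addr0 add0r mulr1.
pose D := diag_mx (vec3 j 1 1).
pose B := invmx E' *m D *m E'.
have DE x y z : vec3 x y z *m D = vec3 (j * x) y z.
  by apply/rowP; elim/ord3P; rewrite mul_mx_diag !mxE /= ?mulr1 1?mulrC.
have j0 : j != 0.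
  by apply/eqP => j0; move/eqP: j2; rewrite j0 expr0n eq_sym oppr_eq0 oner_eq0.
have uB : B \in unitmx.
  rewrite /B !unitmx_mul unitmx_inv uE' andbT /= unitmxE det_diag.
  by rewrite prod3 !mxE /= !mulr1 unitfE.
have CB : preserves (map_mpoly iota C) B.
  move=> p; rewrite -!/(form_at iota C _).
  have -> : p = p *m invmx E' *m E' by rewrite mulmxKV.
  rewrite /B !mulmxA mulmxK // (vec3E (p *m invmx E')) DE !Cev q0 q1 q2.
  rewrite /even_quartic !rmorph0 !mul0r !addr0 !mulr0 !addr0.
  by rewrite exprMn -[4%N]/(2 * 2)%N (exprM j) j2 expr2 mulrNN !mul1r.
have EB i : row i E' *m B = vec3 j 1 1 0 i *: row i E'.
  rewrite -row_mul /B !mulmxA mulmxV // mul1mx row_mul.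
  by apply/rowP=> l; rewrite -row_mul mul_diag_mx !mxE.
have row0 i : row i E' != 0.
  rewrite rowE; apply: row_mul_neq0 => //.
  by apply/eqP=> /rowP/(_ i)/eqP; rewrite !mxE !eqxx oner_eq0.
have scal_inj i (a b : K) : a *: row i E' = b *: row i E' -> a = b.
  move/eqP; rewrite -subr_eq0 -scalerBl scaler_eq0 (negPf (row0 i)) orbF
    subr_eq0.
  by move/eqP.
have j_sq : j ^+ 2 = 1.
  have [b [Db|Db]] := CA B uB CB.
    have Eb i : b = vec3 j 1 1 0 i.
      by apply: (scal_inj i); rewrite -EB Db mul_mx_scalar.
    by have := Eb 0; rewrite (Eb 1) !mxE /= => <-; rewrite expr1n.
  have Eb i : b * (-1) ^+ (s (+) (i == 0)) = vec3 j 1 1 0 i.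
    by apply: (scal_inj i); rewrite -EB Db -scalemxAr E'M scalerA.
  have := Eb 0; rewrite addbT signrN mulrN => Ej.
  have := Eb 1; rewrite addbF => E1.
  by move: Ej; rewrite E1 !mxE /= => <-; rewrite sqrrN expr1n.
by move: two_K; rewrite mulr2n -{1}j_sq j2 addNr eqxx.
Qed.

End Reduction.

(** * Normal forms over a finite field *)

Section FiniteFieldSquares.

Variables (k : finFieldType) (alpha : k).
Hypothesis nsq_alpha : forall t : k, t ^+ 2 != alpha.

Lemma nonsquare_neq0 : alpha != 0.
Proof. by rewrite eq_sym -[0](expr0n k 2) nsq_alpha. Qed.

(** The unit group is cyclic and the nonsquare [alpha] is an odd power of a generator, so [u] or
    [alpha * u] is an even power. *)
Lemma square_class (u : k) : u != 0 ->
  exists2 t, t != 0 & u = t ^+ 2 \/ u = alpha * t ^+ 2.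
Proof.
move=> u0; have /cyclicP[g Dg] := field_unit_group_cyclic [set: {unit k}]%G.
have pow (x : k) : x != 0 -> exists n, x = FinRing.uval g ^+ n.
  move=> x0; have Ux : x \is a GRing.unit by rewrite unitfE.
  have : FinRing.unit k Ux \in <[g]>%g by rewrite -Dg inE.
  by case/cycleP=> n Dn; exists n; rewrite -FinRing.val_unitX -Dn.
have [n Dn] := pow u u0; have [m Dm] := pow alpha nonsquare_neq0.
have g0 : FinRing.uval g != 0 by rewrite -unitfE; exact: (valP g).
have odd_m : odd m.
  apply: contraT => em; have := nsq_alpha (FinRing.uval g ^+ m./2).
  by rewrite -exprM muln2 even_halfK // -Dm eqxx.
have [on|en] := boolP (odd n); last first.
  exists (FinRing.uval g ^+ n./2); first by rewrite expf_neq0.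
  by left; rewrite -exprM muln2 even_halfK.
have em : ~~ odd (m + n) by rewrite oddD odd_m on.
exists (FinRing.uval g ^+ (m + n)./2 / alpha).
  by rewrite mulf_neq0 ?expf_neq0 ?invr_neq0 ?nonsquare_neq0.
right; rewrite expr_div_n -exprM muln2 even_halfK // exprD -Dn -Dm.
by field; exact: nonsquare_neq0.
Qed.

(* If a ^+ 2 - alpha were always a square, the set of squares would be stable *)
(* under the translation by - alpha, hence, being finite, under alpha.        *)
Lemma exists_nonsquare_norm : exists a : k, forall t, a ^+ 2 - alpha != t ^+ 2.
Proof.
pose S := [set t ^+ 2 | t : k].
have [/forallP sq|] := boolP [forall a : k, a ^+ 2 - alpha \in S]; last first.
  rewrite negb_forall => /existsP[a aS]; exists a => t.
  by apply: contraNneq aS => ->; apply/imsetP; exists t.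
have stab : [set x - alpha | x in S] = S.
  apply/eqP; rewrite eqEcard [X in (_ <= X)%N]card_imset ?leqnn ?andbT;
    last first.
    by move=> x1 x2 E; rewrite -(subrK alpha x1) E subrK.
  by apply/subsetP=> _ /imsetP[_ /imsetP[a _ ->] ->].
have : 0 \in S by apply/imsetP; exists 0; rewrite ?expr0n.
rewrite -stab => /imsetP[_ /imsetP[t _ ->]] /esym/eqP.
by rewrite subr_eq0 (negPf (nsq_alpha t)).
Qed.

(** Squares are norms with [b = 0]. Some norm [a^2 - alpha] is a nonsquare [alpha v^2], and scaling
    it by [(t / v)^2] reaches [alpha t^2]. *)
Lemma norm_surjective (u : k) : u != 0 -> exists a b, a ^+ 2 - alpha * b ^+ 2 =
  u.
Proof.
move=> /square_class[t t0 [->|->]]; first by exists t, 0;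
  rewrite expr0n mulr0 subr0.
have [a na] := exists_nonsquare_norm.
have [|v v0 [Dv|Dv]] := @square_class (a ^+ 2 - alpha).
- by have := na 0; rewrite expr0n.
- by have := na v; rewrite Dv eqxx.
exists (a * t / v), (t / v).
have -> : (a * t / v) ^+ 2 - alpha * (t / v) ^+ 2 =
  (a ^+ 2 - alpha) * (t / v) ^+ 2.
  by ring.
by rewrite Dv; field; exact: v0.
Qed.

End FiniteFieldSquares.

(** * Linear substitutions in [y] and [z] *)

Section Substitution.

Variables (k : fieldType) (K : closedFieldType) (iota : {rmorphism k -> K}).
Variable C : {mpoly k[3]}.

Definition equiv_even q0 q1 q2 r0 r1 r2 r3 r4 := exists (E : 'M[k]_3) (a : k),
  [/\ E \in unitmx, a != 0 & forall x y z,
    iota a * form_at iota C (vec3 x y z *m map_mx iota E) =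
    even_quartic 1 (iota q0) (iota q1) (iota q2)
      (iota r0) (iota r1) (iota r2) (iota r3) (iota r4) x y z].

Definition yz_mx (R : comNzRingType) (s t u w : R) : 'M[R]_3 :=
  \matrix_(i, j) nth 0
    (nth [::] [:: [:: 1; 0; 0]; [:: 0; s; u]; [:: 0; t; w]] i) j.

Lemma vec3_yz_mx (R : comNzRingType) (s t u w x y z : R) :
  vec3 x y z *m yz_mx s t u w = vec3 x (s * y + t * z) (u * y + w * z).
Proof.
by apply/rowP; elim/ord3P; rewrite !mxE sum3 !mxE /=; ring.
Qed.

Lemma yz_mx_unit (s t u w : k) : s * w - t * u != 0 -> yz_mx s t u w \in unitmx.
Proof.
set d := _ - _ => d0.
suff /mulmx1_unit[] :
  yz_mx s t u w *m yz_mx (w / d) (- t / d) (- u / d) (s / d) = 1%:M by [].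
apply/matrixP; elim/ord3P; elim/ord3P; rewrite !mxE sum3 !mxE /=;
  rewrite ?mulr0 ?mul0r ?mulr1 ?addr0 ?add0r //; rewrite /d in d0 *; field;
    exact: d0.
Qed.

Lemma equiv_even_subst q0 q1 q2 r0 r1 r2 r3 r4 s t u w :
    s * w - t * u != 0 -> equiv_even q0 q1 q2 r0 r1 r2 r3 r4 ->
  equiv_even (q0 * s ^+ 2 + q1 * s * u + q2 * u ^+ 2)
    (2%:R * q0 * s * t + q1 * (s * w + t * u) + 2%:R * q2 * u * w)
    (q0 * t ^+ 2 + q1 * t * w + q2 * w ^+ 2)
    (r0 * s ^+ 4 + r1 * s ^+ 3 * u + r2 * s ^+ 2 * u ^+ 2 + r3 * s * u ^+ 3 + r4
      * u ^+ 4)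
    (4%:R * r0 * s ^+ 3 * t + r1 * (s ^+ 3 * w + 3%:R * s ^+ 2 * t * u)
     + r2 * (2%:R * s * t * u ^+ 2 + 2%:R * s ^+ 2 * u * w)
     + r3 * (t * u ^+ 3 + 3%:R * s * u ^+ 2 * w) + 4%:R * r4 * u ^+ 3 * w)
    (6%:R * r0 * s ^+ 2 * t ^+ 2 + r1 * (3%:R * s ^+ 2 * t * w + 3%:R * s * t ^+
      2 * u)
     + r2 * (s ^+ 2 * w ^+ 2 + t ^+ 2 * u ^+ 2 + 4%:R * s * t * u * w)
     + r3 * (3%:R * t * u ^+ 2 * w + 3%:R * s * u * w ^+ 2) +
         6%:R * r4 * u ^+ 2 * w ^+ 2)
    (4%:R * r0 * s * t ^+ 3 + r1 * (t ^+ 3 * u + 3%:R * s * t ^+ 2 * w)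
     + r2 * (2%:R * s * t * w ^+ 2 + 2%:R * t ^+ 2 * u * w)
     + r3 * (s * w ^+ 3 + 3%:R * t * u * w ^+ 2) + 4%:R * r4 * u * w ^+ 3)
    (r0 * t ^+ 4 + r1 * t ^+ 3 * w + r2 * t ^+ 2 * w ^+ 2 + r3 * t * w ^+ 3 + r4
      * w ^+ 4).
Proof.
move=> d0 [E [a [uE a0 CE]]]; exists (yz_mx s t u w *m E), a; split=> //.
  by rewrite unitmx_mul yz_mx_unit.
move=> x y z; have -> : vec3 x y z *m map_mx iota (yz_mx s t u w *m E) =
    vec3 x (iota s * y + iota t * z) (iota u * y + iota w * z) *m map_mx iota E.
  rewrite map_mxM mulmxA -vec3_yz_mx; congr (_ *m _ *m _).
  apply/matrixP; elim/ord3P; elim/ord3P; rewrite !mxE /= ?rmorph1 ?rmorph0 //.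
rewrite CE /even_quartic !rmorphD !rmorphM !rmorph_nat /=.
by ring.
Qed.

Lemma equiv_even_scale q0 q1 q2 r0 r1 r2 r3 r4 s w : s != 0 -> w != 0 ->
    equiv_even q0 q1 q2 r0 r1 r2 r3 r4 ->
  equiv_even (q0 * s ^+ 2) (q1 * s * w) (q2 * w ^+ 2) (r0 * s ^+ 4)
    (r1 * s ^+ 3 * w) (r2 * s ^+ 2 * w ^+ 2) (r3 * s * w ^+ 3) (r4 * w ^+ 4).
Proof.
move=> s0 w0 H; have d0 : s * w - 0 * 0 != 0 by rewrite mulr0 subr0 mulf_neq0.
have := equiv_even_subst d0 H.
by rewrite !expr0n /= !(mulr0, mul0r, addr0, add0r) !mulrA.
Qed.

End Substitution.

(** * Classification of the binary quadratic form [q] *)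

Section NormalForms.

Variables (k : finFieldType) (K : closedFieldType) (iota : {rmorphism k -> K}).
Variables (C : {mpoly k[3]}) (alpha : k).
Hypothesis two_neq0 : (2%:R : k) != 0.
Hypothesis nsq_alpha : forall t : k, t ^+ 2 != alpha.

Local Notation equiv_even := (equiv_even iota C).

(** The binary quartic [r] is left unspecified while [q] is being normalised. *)
Definition equiv_conic q0 q1 q2 := exists r0 r1 r2 r3 r4,
  equiv_even q0 q1 q2 r0 r1 r2 r3 r4.

Lemma equiv_conic_subst q0 q1 q2 s t u w q0' q1' q2' :
    equiv_conic q0 q1 q2 -> s * w - t * u != 0 ->
    q0 * s ^+ 2 + q1 * s * u + q2 * u ^+ 2 = q0' ->
    2%:R * q0 * s * t + q1 * (s * w + t * u) + 2%:R * q2 * u * w = q1' ->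
    q0 * t ^+ 2 + q1 * t * w + q2 * w ^+ 2 = q2' ->
  equiv_conic q0' q1' q2'.
Proof.
move=> [r0 [r1 [r2 [r3 [r4 H]]]]] d0 <- <- <-.
by do 5!eexists; apply: (equiv_even_subst d0 H).
Qed.

Definition normal_conic := [\/ equiv_conic 1 0 0 \/ equiv_conic alpha 0 0,
  equiv_conic 0 1 0 | equiv_conic 1 0 (- alpha)].

(** The type is read off [- d / q]: zero gives rank one, a square a split form, a nonsquare an
    anisotropic one. *)
Lemma diagonal_conic q d : q != 0 -> equiv_conic q 0 d -> normal_conic.
Proof.
move=> q0 Hq; have a0 := nonsquare_neq0 nsq_alpha.
have [d0|d0] := eqVneq d 0.
  rewrite d0 in Hq; have [m m0 [Dq|Dq]] := square_class nsq_alpha q0.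
    apply: Or31; left; apply:
      (equiv_conic_subst (s := m^-1) (t := 0) (u := 0) (w := 1) Hq).
    - by rewrite mulr1 mulr0 subr0 invr_neq0.
    - by rewrite Dq; field.
    - by ring.
    by ring.
  apply: Or31; right; apply:
    (equiv_conic_subst (s := m^-1) (t := 0) (u := 0) (w := 1) Hq).
  - by rewrite mulr1 mulr0 subr0 invr_neq0.
  - by rewrite Dq; field.
  - by ring.
  by ring.
have dq0 : - d / q != 0 by rewrite mulf_neq0 ?invr_neq0 ?oppr_eq0.
have [m m0 [Dd|Dd]] := square_class nsq_alpha dq0.
  have {}Dd : d = - (q * m ^+ 2) by rewrite -Dd; field.
  (* Writing [Y], [Z] for the old variables, the substitution is chosen so that [Y - m Z = y / q]
     and [Y + m Z = z]; hence [q (Y^2 - m^2 Z^2) = y z]. *)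
  apply: Or32; apply: (equiv_conic_subst (s := (2%:R * q)^-1) (t := 2%:R^-1)
    (u := - (2%:R * m * q)^-1) (w := (2%:R * m)^-1) Hq).
  - rewrite (_ : _ - _ = (2%:R * m * q)^-1) ?invr_neq0 ?mulf_neq0 //.
    by field; rewrite ?q0 ?m0 ?two_neq0.
  - by rewrite Dd; field; rewrite ?q0 ?m0 ?two_neq0.
  - by rewrite Dd; field; rewrite ?q0 ?m0 ?two_neq0.
  by rewrite Dd; field; rewrite ?q0 ?m0 ?two_neq0.
have {}Dd : d = - (q * alpha * m ^+ 2) by rewrite -mulrA -Dd; field.
have [a [b Dab]] := norm_surjective nsq_alpha (invr_neq0 q0).
have Dq : q * (a ^+ 2 - alpha * b ^+ 2) = 1 by rewrite Dab mulfV.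
(* With [w = sqrt(alpha)], this is [Y + w m Z = (a + b w)(y + w z)]: the norm of [y + w z] is
   multiplied by that of [a + b w], which is [1 / q]. *)
apply: Or33; apply: (equiv_conic_subst (s := a) (t := alpha * b)
  (u := b / m) (w := a / m) Hq).
- rewrite (_ : _ - _ = (a ^+ 2 - alpha * b ^+ 2) / m); last by ring.
  by rewrite Dab mulf_neq0 ?invr_neq0.
- by rewrite -[RHS]Dq Dd; field.
- by rewrite Dd; field.
by rewrite -[alpha in RHS]mulr1 -Dq Dd; field.
Qed.

(** Completing the square diagonalises [q] if [q0] or, after exchanging [y] and [z], [q2] is
    nonzero; otherwise [q] is already a multiple of [y z]. *)
Lemma conic_normal_form q0 q1 q2 : ~~ [&& q0 == 0, q1 == 0 & q2 == 0] ->
  equiv_conic q0 q1 q2 -> normal_conic.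
Proof.
have sq_case p0 p1 p2 : p0 != 0 -> equiv_conic p0 p1 p2 -> normal_conic.
  move=> p00 Hp; apply: (diagonal_conic (d := p2 - p1 ^+ 2 / (4%:R * p0)) p00).
  have four0 : (4%:R : k) != 0 by rewrite (natrM _ 2 2) mulf_neq0.
  apply: (equiv_conic_subst (s := 1) (t := - (p1 / (2%:R * p0))) (u := 0) (w :=
    1) Hp).
  - by rewrite !mulr0 subr0 mulr1 oner_neq0.
  - by ring.
  - by field; rewrite p00 two_neq0.
  by field; rewrite p00 two_neq0 four0.
move=> nz Hq; have [q00|q00] := eqVneq q0 0; last exact: sq_case q00 Hq.
have [q20|q20] := eqVneq q2 0; last first.
  apply: (sq_case q2 q1 q0 q20).
  apply: (equiv_conic_subst (s := 0) (t := 1) (u := 1) (w := 0) Hq);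
    try by ring.
  by rewrite mul0r mulr1 sub0r oppr_eq0 oner_neq0.
have q10 : q1 != 0 by move: nz; rewrite q00 q20 eqxx andbT.
apply: Or32; apply: (equiv_conic_subst (s := q1^-1) (t := 0) (u := 0) (w :=
  1) Hq).
- by rewrite mulr1 mulr0 subr0 invr_neq0.
- by rewrite q00; ring.
- by rewrite q00 q20; field.
by rewrite q20; ring.
Qed.

Definition even_mpoly q0 q1 q2 r0 r1 r2 r3 r4 : {mpoly k[3]} :=
  even_quartic 1 q0%:MP q1%:MP q2%:MP r0%:MP r1%:MP r2%:MP r3%:MP r4%:MP
    'X_0 'X_1 'X_2.

Lemma even_mpoly_homog q0 q1 q2 r0 r1 r2 r3 r4 :
  even_mpoly q0 q1 q2 r0 r1 r2 r3 r4 \is 4.-homog.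
Proof.
have hC c d (P : {mpoly k[3]}) : P \is d.-homog -> c%:MP * P \is d.-homog.
  by rewrite mul_mpolyC; apply: dhomogZ.
have hX (i : 'I_3) : ('X_i : {mpoly k[3]}) \is 1.-homog.
  by rewrite dhomogX /= mdeg1.
have hXn (i : 'I_3) n : ('X_i ^+ n : {mpoly k[3]}) \is n.-homog.
  by have := dhomogMn n (hX i); rewrite mul1n.
rewrite /even_mpoly /even_quartic mul1r.
apply: dhomogD; last exact/hC/hXn.
apply: dhomogD; last exact: dhomogM (hC _ _ _ (hX 1)) (hXn 2 3).
apply: dhomogD; last exact: dhomogM (hC _ _ _ (hXn 1 2)) (hXn 2 2).
apply: dhomogD; last exact: dhomogM (hC _ _ _ (hXn 1 3)) (hX 2).
apply: dhomogD; last exact/hC/hXn.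
apply: dhomogD; first exact: hXn.
apply: dhomogM (hXn 0 2) _.
apply: dhomogD; last exact/hC/hXn.
apply: dhomogD; first exact/hC/hXn.
exact: dhomogM (hC _ _ _ (hX 1)) (hX 2).
Qed.

Lemma form_at_even_mpoly q0 q1 q2 r0 r1 r2 r3 r4 (p : 'rV[K]_3) :
  form_at iota (even_mpoly q0 q1 q2 r0 r1 r2 r3 r4) p =
  even_quartic 1 (iota q0) (iota q1) (iota q2)
      (iota r0) (iota r1) (iota r2) (iota r3) (iota r4) (p 0 0) (p 0 1) (p 0 2).
Proof.
have fC c : mmap iota (p 0) c%:MP = iota c by rewrite mmapC.
have fX i : mmap iota (p 0) 'X_i = p 0 i by rewrite mmapX mmap1U.
by rewrite form_at_mmap rmorph_even_quartic rmorph1 /= !fC !fX.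
Qed.

Lemma equiv_even_curve q0 q1 q2 r0 r1 r2 r3 r4 C' :
    smooth_plane_quartic iota C -> equiv_even q0 q1 q2 r0 r1 r2 r3 r4 ->
    C' = even_mpoly q0 q1 q2 r0 r1 r2 r3 r4 ->
  smooth_plane_quartic iota C' /\ curves_isomorphic iota C C'.
Proof.
move=> smC [E [a [uE a0 CE]]] ->; apply: (quartic_transfer uE a0 smC).
  exact: even_mpoly_homog.
by move=> p; rewrite [p in RHS]vec3E CE form_at_even_mpoly.
Qed.

End NormalForms.

Theorem proposition3p5 (k : finFieldType) (K : closedFieldType)
    (iota : {rmorphism k -> K})
    (* K is an algebraic closure of k *)
    (algK : forall u : K, algebraicOver iota u)
    (chark : 2%N \notin [pchar k])
    (C : {mpoly k[3]}) (smoothC : smooth_plane_quartic iota C)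
    (autC : geom_aut_group_isog iota C 'Z_2)
    (alpha : k) (nsq_alpha : forall t : k, t ^+ 2 != alpha) :
  exists C' : {mpoly k[3]},
    [/\ smooth_plane_quartic iota C',
        curves_isomorphic iota C C'
      & [\/ exists eps a mu b c d : k,
              [/\ eps \in [:: 1; alpha], mu \in [:: 0; 1]
                & C' = quartic_i eps a mu b c d],
            exists a eps b c d : k,
              eps \in [:: 0; 1; alpha] /\ C' = quartic_ii a eps b c d
          | exists a b c d e : k, C' = quartic_iii alpha a b c d e]].
Proof.
have two_neq0 : (2%:R : k) != 0 by move: chark; rewrite inE.
have [E [a [q0 [q1 [q2 [r0 [r1 [r2 [r3 [r4 [uE a0 nz CE]]]]]]]]]]] :=
  even_reduction two_neq0 smoothC autC.
have HC : equiv_conic iota C (q0 / a) (q1 / a) (q2 / a).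
  exists (r0 / a), (r1 / a), (r2 / a), (r3 / a), (r4 / a), E, a^-1; split=> //.
    by rewrite invr_neq0.
  move=> x y z; rewrite CE /even_quartic !rmorphM fmorphV /=.
  by field; rewrite fmorph_eq0.
have {}nz : ~~ [&& q0 / a == 0, q1 / a == 0 & q2 / a == 0].
  by rewrite !mulf_eq0 invr_eq0 (negPf a0) !orbF.
have curve := equiv_even_curve smoothC.
have mem2 : (1 : k) \in [:: 1; alpha] /\ alpha \in [:: 1; alpha].
  by rewrite !inE !eqxx orbT.
have case_i eps : eps \in [:: 1; alpha] -> equiv_conic iota C eps 0 0 ->
  exists C' : {mpoly k[3]},
    [/\ smooth_plane_quartic iota C', curves_isomorphic iota C C'
    & exists eps a mu b c d : k, [/\ eps \in [:: 1; alpha], mu \in [:: 0; 1]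
        & C' = quartic_i eps a mu b c d]].
  move=> heps [r0' [r1' [r2' [r3' [r4' H]]]]].
  have [mu [b0 [b2 [b3 [b4 [hmu {}H]]]]]] : exists mu b0 b2 b3 b4,
      mu \in [:: 0; 1] /\ equiv_even iota C eps 0 0 b0 mu b2 b3 b4.
    have [r10|r10] := eqVneq r1' 0.
      by exists 0, r0', r2', r3', r4'; rewrite r10 in H; rewrite inE eqxx.
    (* Scaling [z] alone leaves [eps y^2] unchanged and makes the coefficient of [y^3 z] equal to
       1. *)
    exists 1; do 4!eexists; split; first by rewrite !inE eqxx orbT.
    have := equiv_even_scale (oner_neq0 k) (invr_neq0 r10) H.
    rewrite !expr1n !mulr1 !mul0r mulfV //; exact.
  have [|sm iso] := curve _ _ _ _ _ _ _ _ (quartic_i eps b0 mu b2 b3 b4) H.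
    rewrite /quartic_i -!mul_mpolyC /even_mpoly mpolyC0 /even_quartic.
    by ring.
  by exists (quartic_i eps b0 mu b2 b3 b4); split=> //;
    exists eps, b0, mu, b2, b3, b4.
case: (conic_normal_form two_neq0 nsq_alpha nz HC) => [Hi|Hii|Hiii].
- have [C' [sm iso H]] : exists C' : {mpoly k[3]},
      [/\ smooth_plane_quartic iota C', curves_isomorphic iota C C'
        & exists eps a mu b c d : k, [/\ eps \in [:: 1; alpha], mu \in [:: 0; 1]
            & C' = quartic_i eps a mu b c d]].
    by case: Hi; apply: case_i; case: mem2.
  by exists C'; split=> //; apply: Or31.
- case: Hii => [r0' [r1' [r2' [r3' [r4' H]]]]].
  have [eps [b0 [b2 [b3 [b4 [heps {}H]]]]]] : exists eps b0 b2 b3 b4,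
      eps \in [:: 0; 1; alpha] /\ equiv_even iota C 0 1 0 b0 eps b2 b3 b4.
    have [r10|r10] := eqVneq r1' 0.
      by exists 0, r0', r2', r3', r4'; rewrite r10 in H; rewrite inE eqxx.
    have [m m0 Dr1] := square_class nsq_alpha r10.
    (* Scaling [y] by [1 / m] and [z] by [m] fixes [y z] and divides the coefficient of [y^3 z] by
       [m^2], which leaves its square class, 1 or [alpha]. *)
    have H' := equiv_even_scale (invr_neq0 m0) m0 H.
    case: Dr1 => Dr1; [exists 1 | exists alpha]; do 4!eexists; split;
      try by rewrite !inE eqxx ?orbT.
    + move: H'; rewrite !mul0r mul1r mulVf //.
      have -> : r1' * m^-1 ^+ 3 * m = 1 by rewrite Dr1; field.
      exact.
    move: H'; rewrite !mul0r mul1r mulVf //.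
    have -> : r1' * m^-1 ^+ 3 * m = alpha by rewrite Dr1; field.
    exact.
  have [|sm iso] := curve _ _ _ _ _ _ _ _ (quartic_ii b0 eps b2 b3 b4) H.
    rewrite /quartic_ii -!mul_mpolyC /even_mpoly mpolyC0 mpolyC1 /even_quartic.
    by ring.
  exists (quartic_ii b0 eps b2 b3 b4); split=> //.
  by apply: Or32; exists b0, eps, b2, b3, b4.
case: Hiii => [b0 [b1 [b2 [b3 [b4 H]]]]].
have [|sm iso] := curve _ _ _ _ _ _ _ _ (quartic_iii alpha b0 b1 b2 b3 b4) H.
  rewrite /quartic_iii -!mul_mpolyC /even_mpoly mpolyCN mpolyC0 mpolyC1
    /even_quartic.
  by ring.
exists (quartic_iii alpha b0 b1 b2 b3 b4); split=> //.
by apply: Or33; exists b0, b1, b2, b3, b4.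
Qed.
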